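(* Let $n\ge 3$ and let $\Omega_1$ be a smooth, bounded, strictly convex domain in $\mathbb{R}^n$. Then the solution $u\in C^\infty(\mathbb{R}^n\setminus\Omega_1)$ of the problem $$\begin{cases}\Delta u=0\quad\text{in }\mathbb{R}^n\setminus\bar\Omega_1,\\ u=1\quad\text{on }\partial\Omega_1,\\ \lim\limits_{|x|\to\infty}u(x)=0\end{cases}$$ is quasiconcave. Moreover, the superlevel sets of $u$ are all strictly convex, where $u$ is extended by $u=1$ in $\Omega_1$.
   Context: $u$ is called quasiconcave if, after extending $u$ by the value $1$ in $\Omega_1$, all superlevel sets $\{x\in\mathbb{R}^n: u(x)\ge t\}$ are convex. $C^\infty(\mathbb{R}^n\setminus\Omega_1)$ means smooth up to the boundary $\partial\Omega_1$. *)

(* Defs.v *)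
From mathcomp Require Import all_boot all_order all_algebra.
From mathcomp Require Import all_classical all_reals all_analysis.

Set Implicit Arguments.
Unset Strict Implicit.
Unset Printing Implicit Defensive.

Import Order.TTheory GRing.Theory Num.Theory.
Import numFieldNormedType.Exports.

Local Open Scope classical_set_scope.
Local Open Scope ring_scope.

(* R^n is 'rV[R]_n with the library's sup norm: its topology, its bounded sets
   and the meaning of |x| -> oo are those of the Euclidean norm. *)

Definition partial (R : realType) (n : nat) (i : 'I_n) (f : 'rV[R]_n -> R) :
  'rV[R]_n -> R := fun x => 'D_(delta_mx 0 i) f x.

Definition iter_partial (R : realType) (n : nat) (s : seq 'I_n)
  (f : 'rV[R]_n -> R) : 'rV[R]_n -> R := foldr (@partial R n) f s.

(* C^oo on U; intended for open U, where iterated partial derivatives at the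
   points of U depend only on the restriction of f to U. *)
Definition smooth_on (R : realType) (n : nat) (U : set 'rV[R]_n)
    (f : 'rV[R]_n -> R) : Prop :=
  forall (s : seq 'I_n) (x : 'rV[R]_n), U x ->
    {for x, continuous (iter_partial s f)} /\
    (forall i : 'I_n, derivable (iter_partial s f) x (delta_mx 0 i)).

(* C^oo(F) for a set F which is the closure of its interior: f is continuous on
   F, smooth in the interior, and each iterated partial derivative extends
   continuously from the interior to F. The values of f outside F are
   irrelevant. *)
Definition smooth_up_to_boundary (R : realType) (n : nat) (F : set 'rV[R]_n)
    (f : 'rV[R]_n -> R) : Prop :=
  [/\ {within F, continuous f},
      smooth_on (interior F) f &
      forall s : seq 'I_n, exists g : 'rV[R]_n -> R,
        {within F, continuous g} /\
        (forall x, interior F x -> g x = iter_partial s f x)].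

Definition laplacian (R : realType) (n : nat) (f : 'rV[R]_n -> R) :
  'rV[R]_n -> R := fun x => \sum_(i < n) partial i (partial i f) x.

Definition boundary (R : realType) (n : nat) (A : set 'rV[R]_n) :
  set 'rV[R]_n := closure A `\` interior A.

Definition domain (R : realType) (n : nat) (A : set 'rV[R]_n) : Prop :=
  [/\ open A, connected A & A !=set0].

(* Near each boundary point, A is the sublevel set of a smooth function with
   nonvanishing gradient. *)
Definition smooth_boundary (R : realType) (n : nat) (A : set 'rV[R]_n) : Prop :=
  forall p, boundary A p ->
    exists (U : set 'rV[R]_n) (rho : 'rV[R]_n -> R),
      [/\ open U, U p, smooth_on U rho,
          (exists i : 'I_n, partial i rho p != 0) &
          forall x, U x -> (A x <-> rho x < 0)].

(* The endpoints range over the closure, so that the notion is meaningful for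
   open sets as well as closed ones. *)
Definition strictly_convex (R : realType) (n : nat) (A : set 'rV[R]_n) : Prop :=
  forall (x y : 'rV[R]_n) (t : R), closure A x -> closure A y -> x != y ->
    0 < t < 1 -> interior A (t *: x + (1 - t) *: y).

Definition tends_to_at_infinity (R : realType) (n : nat) (f : 'rV[R]_n -> R)
    (l : R) : Prop :=
  forall e : R, 0 < e -> exists M : R, forall x, M < `|x| -> `|f x - l| < e.

Definition extend_by_one (R : realType) (n : nat) (A : set 'rV[R]_n)
  (f : 'rV[R]_n -> R) : 'rV[R]_n -> R := patch f A (cst 1).

Definition superlevel (R : realType) (n : nat) (f : 'rV[R]_n -> R) (t : R) :
  set 'rV[R]_n := [set x | t <= f x].

Definition quasiconcave (R : realType) (n : nat) (A : set 'rV[R]_n)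
    (f : 'rV[R]_n -> R) : Prop :=
  forall t : R, convex_set (superlevel (extend_by_one A f) t).

(* Main.v *)
Require Import Defs.
From mathcomp Require Import all_boot all_order all_algebra.
From mathcomp Require Import all_classical all_reals all_analysis.
From mathcomp Require Import ring lra.
Import Order.TTheory GRing.Theory Num.Theory.
Import numFieldNormedType.Exports.
Local Open Scope classical_set_scope.
Local Open Scope ring_scope.
Set Implicit Arguments.
Unset Strict Implicit.
Unset Printing Implicit Defensive.

(** Let v be u extended by 1 and C the closure of Omega1.  Then v is
    continuous, equal to 1 on the compact convex set C, harmonic off C, and it
    vanishes at infinity; [extension_capacitary] records this and everything
    else is about such pairs (C, v).

    Comparison.  The weak maximum principle gives 0 <= v <= 1.  If an
    affine function l with coefficients at most 1 is nonpositive on C, then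
    v <= 1 - c l wherever l >= 0 on a given bounded set, with c independent of
    l ([half_space_bound]): l is harmonic, v is small at infinity, and where
    l = 0 the bound is v <= 1.  This linear barrier replaces the strong
    maximum principle and the Hopf lemma: C being the intersection of its
    half-spaces, v < 1 off C, and the dilations x0 + s (x - x0) about an
    interior point x0 satisfy v (x0 + s (x - x0)) <= (1 - c (s - 1)) v x
    ([radial_decay]), whence the gradient of v does not vanish where v > 0.

    Convexity.  Put w = g v with g r = r + r^3 / 12, and look at a positive
    maximum of the two-point function of Gabriel,
    min (w x) (w y) - w z with z = t x + (1 - t) y; it exists because v tends
    to 0.  If v y < v x, moving x and y with z fixed shows that y is a local
    maximum of v, which the gradient forbids.  So v x = v y and x, y, z all
    lie off C.  The first-order condition makes the gradients of w at x, y, z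
    parallel, say sigma D, tau D and D, with
    t / sigma + (1 - t) / tau = 1 ([gradients_parallel]).  Moving x, y, z by
    e / sigma, e / tau, e changes w to first order by the same amount at the
    three points, and the second-order condition says that
    t / sigma (D^2 w x) / sigma^2 + (1 - t) / tau (D^2 w y) / tau^2 - D^2 w z
    is nonpositive in each coordinate direction ([gabriel_max_second]).  As v
    is harmonic, the Laplacian of w is k (v) times the square of its gradient,
    where k = g'' / g'^2; the trace of the inequality is k (v x) <= k (v z).
    But v z < v x and k increases strictly on [0, 1] ([cubic_ratio_lt]).  With
    g the identity k would vanish and no contradiction would follow: the cubic
    term supplies the strictness.

    Strict convexity.  Let 0 < t < 1 and let x, y be points of {t <= v} with a
    point of the open chord off the interior.  If v > t somewhere on the
    chord, convexity would put that point in the interior; so v = t on the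
    whole chord.  Harmonic functions are analytic along lines, so v = t on the
    whole ray from x through y, against the decay at infinity.  Analyticity is
    used in the form [harmonic_continuation]: on cubes the k-th difference
    with step u is at most (n^2 |u| / eta)^k, 2 eta being the loss of radius
    in each of the k steps, and a function which vanishes at k consecutive points
    of a progression and has a small k-th difference stays small further on.
    For t <= 0 the superlevel set is the whole space, for t = 1 it is C, and
    for t > 1 it is empty.

    Laplacians are read off second-order expansions along the coordinate axes
    ([taylor2]); these are stable under sums, translations, dilations and
    reflections, so that no mixed derivative has to be handled. *)

(** * The dot product and coordinates *)

Section Vectors.
Context {R : realType} {n : nat}.
Implicit Types (x y a b c p : 'rV[R]_n) (r s : R).

Definition dot a b : R := \sum_(i < n) a 0 i * b 0 i.

Lemma dotC a b : dot a b = dot b a.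
Proof. by apply: eq_bigr => i _; rewrite mulrC. Qed.

Lemma dotDr a b c : dot a (b + c) = dot a b + dot a c.
Proof. by rewrite -big_split; apply: eq_bigr => i _ /=; rewrite mxE mulrDr. Qed.

Lemma dotZr s a b : dot a (s *: b) = s * dot a b.
Proof. by rewrite mulr_sumr; apply: eq_bigr => i _; rewrite mxE mulrCA. Qed.

Lemma dotNr a b : dot a (- b) = - dot a b.
Proof. by rewrite -scaleN1r dotZr mulN1r. Qed.

Lemma dotDl a b c : dot (a + b) c = dot a c + dot b c.
Proof. by rewrite !(dotC _ c) dotDr. Qed.

Lemma dotZl s a b : dot (s *: a) b = s * dot a b.
Proof. by rewrite !(dotC _ b) dotZr. Qed.

Lemma dotNl a b : dot (- a) b = - dot a b.
Proof. by rewrite !(dotC _ b) dotNr. Qed.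

Lemma dot0r a : dot a 0 = 0.
Proof. by rewrite -(scale0r (0 : 'rV[R]_n)) dotZr mul0r. Qed.

Lemma dot0l a : dot 0 a = 0.
Proof. by rewrite dotC dot0r. Qed.

Lemma dot_ge0 a : 0 <= dot a a.
Proof. by apply: sumr_ge0 => i _; rewrite -expr2 sqr_ge0. Qed.

Lemma dot_eq0 a : dot a a = 0 -> a = 0.
Proof.
move=> /eqP; rewrite psumr_eq0 => [/allP a0|i _]; last by rewrite -expr2 sqr_ge0.
apply/rowP => i; rewrite mxE; have /implyP := a0 i (mem_index_enum i).
by rewrite mulf_eq0 orbb => /(_ isT)/eqP.
Qed.

Lemma dot_gt0 a : a != 0 -> 0 < dot a a.
Proof.
by move=> a0; rewrite lt0r dot_ge0 andbT; apply: contra a0 => /eqP/dot_eq0->.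
Qed.

Lemma dot_delta a i : dot a (delta_mx 0 i) = a 0 i.
Proof.
rewrite /dot (bigD1 i)//= mxE !eqxx mulr1 big1 ?addr0// => j ji.
by rewrite mxE (negPf ji) andbF mulr0.
Qed.

Lemma coord_le_norm x i : `|x 0 i| <= `|x|.
Proof.
rewrite [leRHS]/Num.norm/= mx_normrE; apply/bigmax_geP; right => /=.
by exists (0, i).
Qed.

Lemma norm_le_coord x r : 0 <= r -> (forall i, `|x 0 i| <= r) -> `|x| <= r.
Proof.
move=> r0 xr; rewrite [leLHS]/Num.norm/= mx_normrE; apply/bigmax_leP; split => //.
by case=> i j _ /=; rewrite (ord1 i).
Qed.

Lemma norm_attained x : x != 0 -> exists i, `|x| = `|x 0 i|.
Proof.
move=> x0; have [|[i j]] := @mx_norm_neq0 R _ _ x.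
  by apply: contra x0 => /eqP/mx_norm_eq0->.
by rewrite (ord1 i) => e; exists j.
Qed.

Lemma norm_delta i : `|delta_mx 0 i : 'rV[R]_n| <= 1.
Proof.
apply: norm_le_coord => // j; rewrite mxE.
by case: (_ && _); rewrite ?normr1 ?normr0.
Qed.

Lemma norm_dot_le a b : `|dot a b| <= n%:R * `|a| * `|b|.
Proof.
apply: le_trans (ler_norm_sum _ _ _) _.
apply: (@le_trans _ _ (\sum_(i < n) `|a| * `|b|)).
  by apply: ler_sum => i _; rewrite normrM ler_pM// coord_le_norm.
by rewrite sumr_const card_ord -[leLHS]mulr_natl mulrA.
Qed.

(** The sup norm is at most the Euclidean one. *)
Lemma normsq_le_dot a : `|a| ^+ 2 <= dot a a.
Proof.
have [->|a0] := eqVneq a 0; first by rewrite normr0 expr0n dot_ge0.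
have [i ->] := norm_attained a0.
rewrite /dot (bigD1 i)//= -normrX ger0_norm ?sqr_ge0// -expr2 lerDl.
by apply: sumr_ge0 => j _; rewrite -expr2 sqr_ge0.
Qed.

Lemma sum_continuous (T : topologicalType) (F : 'I_n -> T -> R) :
  (forall i, continuous (F i)) -> continuous (fun t => \sum_i F i t).
Proof.
move=> cF t; rewrite /continuous_at; elim: (index_enum _) => [|i l IH].
  by under eq_fun do rewrite big_nil; rewrite big_nil; exact: cvg_cst.
under eq_fun do rewrite big_cons; rewrite big_cons.
by apply: cvgD => //; exact: cF.
Qed.

Lemma comb_continuous (f g : 'rV[R]_n -> R) r s :
  continuous f -> continuous g -> continuous (fun x => r * f x + s * g x).
Proof. by move=> cf cg x; exact: (cvgD (cvgMr (cf x)) (cvgMr (cg x))). Qed.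

Lemma coord_continuousR i : continuous (fun x => x 0 i).
Proof. exact: coord_continuous. Qed.

Lemma dot_continuous a : continuous (dot a).
Proof.
apply: sum_continuous => i x.
have c := @coord_continuousR i x; exact: (cvgMr c).
Qed.

Lemma dotsq_continuous p : continuous (fun x => dot (x - p) (x - p)).
Proof.
apply: sum_continuous => i x.
have c : (fun y : 'rV[R]_n => (y - p) 0 i) @ x --> (x - p) 0 i.
  rewrite mxE; under eq_fun do rewrite mxE.
  have c := @coord_continuousR i x; apply: (cvgD c); exact: cvg_cst.
exact: (cvgM c c).
Qed.

Lemma affine_continuous s p : continuous (fun x => s *: x + p).
Proof. by move=> x; exact: (cvgD (cvgZl_tmp cvg_id) (cvg_cst _)). Qed.

End Vectors.

(** * Second-order expansions and the weak maximum principle *)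

Section Taylor.
Context {R : realType} {n : nat}.
Implicit Types (f g : 'rV[R]_n -> R) (x y d p : 'rV[R]_n) (r s a b : R).

(** The limit at 0 along nonzero arguments, in epsilon-delta form: every
    expansion below is a statement of this shape about explicit quotients. *)
Definition lim0 (f : R -> R) (l : R) := forall e : R, 0 < e ->
  exists2 del : R, 0 < del & forall h : R, h != 0 -> `|h| < del -> `|f h - l| < e.

Lemma lim0P (f : R -> R) (l : R) : lim0 f l <-> f @ (0 : R)^' --> l.
Proof.
split=> [fl|fl e e0].
  apply/cvgrPdist_lt => e /fl[del del0 fe]; exists del => //= h.
  by rewrite /ball_/= sub0r normrN distrC => hd h0; exact: fe.
move: fl => /cvgrPdist_lt/(_ e e0)[del /= del0 fe]; exists del => // h h0 hd.
by rewrite distrC; apply: fe => //=; rewrite sub0r normrN.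
Qed.

Lemma lim0_eq (f g : R -> R) l :
  (forall h : R, h != 0 -> f h = g h) -> lim0 f l -> lim0 g l.
Proof.
move=> fg fl e /fl[del del0 fe]; exists del => // h h0 hd.
by rewrite -fg//; exact: fe.
Qed.

Lemma lim0_cst a : lim0 (fun=> a) a.
Proof. by move=> e e0; exists 1 => // h _ _; rewrite subrr normr0. Qed.

Lemma lim0_id : lim0 id 0.
Proof. by move=> e e0; exists e => // h _; rewrite subr0. Qed.

Lemma lim0D (f g : R -> R) a b : lim0 f a -> lim0 g b ->
  lim0 (fun h => f h + g h) (a + b).
Proof. by move=> /lim0P fa /lim0P gb; apply/lim0P; exact: cvgD. Qed.

Lemma lim0M (f g : R -> R) a b : lim0 f a -> lim0 g b ->
  lim0 (fun h => f h * g h) (a * b).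
Proof. by move=> /lim0P fa /lim0P gb; apply/lim0P; exact: cvgM. Qed.

Lemma lim0Z (f : R -> R) a s : lim0 f a -> lim0 (fun h => s * f h) (s * a).
Proof. exact: (lim0M (@lim0_cst s)). Qed.

Lemma lim0_scale (f : R -> R) a s : s != 0 -> lim0 f a ->
  lim0 (fun h => f (s * h)) a.
Proof.
move=> s0 fa e /fa[del del0 fe]; exists (del / `|s|).
  by rewrite divr_gt0// normr_gt0.
move=> h h0 hd; apply: fe; first by rewrite mulf_neq0.
by rewrite normrM mulrC -ltr_pdivlMr// normr_gt0.
Qed.

Lemma lim0_gt0 (f : R -> R) a : 0 < a -> lim0 f a ->
  exists2 del : R, 0 < del & forall h : R, h != 0 -> `|h| < del -> 0 < f h.
Proof.
move=> a0 /(_ a a0)[del del0 fa]; exists del => // h h0 /(fa _ h0).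
by rewrite ltr_norml => /andP[+ _]; rewrite ltrBrDr addNr.
Qed.

Lemma lim0_gt0_below (f : R -> R) (a d : R) : 0 < a -> 0 < d -> lim0 f a ->
  exists h, [/\ 0 < h, h < d & 0 < f h].
Proof.
move=> a0 d0 /(lim0_gt0 a0)[del del0 f0].
pose h := Num.min del d / 2.
have m0 : 0 < Num.min del d by rewrite lt_min del0.
have h0 : 0 < h by rewrite divr_gt0.
have hm : h < Num.min del d by rewrite /h; lra.
have /andP[hdel hd] : (h < del) && (h < d) by rewrite -lt_min.
by exists h; split=> //; apply: f0; rewrite ?lt0r_neq0 ?gtr0_norm.
Qed.

Lemma lim0_gt0_pair (f g : R -> R) a b :
  0 < a -> 0 < b -> lim0 f a -> lim0 g b ->
  exists h, [/\ 0 < h, 0 < f h & 0 < g h].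
Proof.
move=> a0 b0 fa /(lim0_gt0 b0)[d d0 g0].
have [h [h0 hd fh]] := lim0_gt0_below a0 d0 fa.
by exists h; split=> //; apply: g0; rewrite ?lt0r_neq0 ?gtr0_norm.
Qed.

Lemma nbhs_delta x (A : set 'rV[R]_n) : nbhs x A <->
  exists2 del : R, 0 < del & forall y, `|y - x| < del -> A y.
Proof.
split=> [/nbhs_normP[e /= e0 eA]|[e e0 eA]].
  by exists e => // y yx; apply: eA; rewrite /= distrC.
apply/(nbhs_ballP x A); exists e => //= y; rewrite -ball_normE /= distrC.
exact: eA.
Qed.

Lemma nbhs_gt_continuous f x r : continuous f -> r < f x ->
  nbhs x [set y | r < f y].
Proof. by move=> cf rf; exact: (cvgr_gt _ (cf x) _ rf). Qed.

Lemma nbhs_line x d (A : set 'rV[R]_n) : nbhs x A ->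
  exists2 del : R, 0 < del & forall h : R, `|h| < del -> A (x + h *: d).
Proof.
move=> /nbhs_delta[e e0 eA]; exists (e / (`|d| + 1)).
  by rewrite divr_gt0// ltr_wpDl.
move=> h; rewrite ltr_pdivlMr ?ltr_wpDl// => he; apply: eA.
rewrite addrC addKr normrZ; apply: le_lt_trans he.
by rewrite ler_wpM2l// lerDl.
Qed.

(** f (x + h d) = f x + h a + h^2 b / 2 + o(h^2). Only the restriction of f to
    one line is involved, so that a and b are the derivatives along d without
    any regularity of f near that line. *)
Definition taylor2 f x d a b :=
  lim0 (fun h : R => (f (x + h *: d) - f x - h * a) / h ^+ 2) (b / 2).

Lemma taylor2_quadratic f x d a b :
  (forall h : R, f (x + h *: d) = f x + h * a + h ^+ 2 * (b / 2)) ->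
  taylor2 f x d a b.
Proof.
move=> fE; apply: (lim0_eq _ (@lim0_cst (b / 2))) => h h0.
by rewrite fE; field.
Qed.

Lemma taylor2_comb f g x d (a b a' b' r s : R) :
  taylor2 f x d a b -> taylor2 g x d a' b' ->
  taylor2 (fun y => r * f y + s * g y) x d (r * a + s * a') (r * b + s * b').
Proof.
move=> tf tg; rewrite /taylor2.
have -> : (r * b + s * b') / 2 = r * (b / 2) + s * (b' / 2) by field.
by apply: (lim0_eq _ (lim0D (lim0Z r tf) (lim0Z s tg))) => h h0; field.
Qed.

(** Affine changes of variable carry lines to lines; this covers dilations and
    reflections at once. *)
Lemma taylor2_subst (phi : 'rV[R]_n -> 'rV[R]_n) f x d d' a b :
  (forall h : R, phi (x + h *: d) = phi x + h *: d') ->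
  taylor2 f (phi x) d' a b -> taylor2 (f \o phi) x d a b.
Proof.
by move=> phiE; apply: lim0_eq => h h0; rewrite /= phiE.
Qed.

Lemma taylor2_dirZ f x d a b s : s != 0 ->
  taylor2 f x d a b -> taylor2 f x (s *: d) (s * a) (s ^+ 2 * b).
Proof.
move=> s0 tf; rewrite /taylor2 -mulrA.
apply: (lim0_eq _ (lim0Z (s ^+ 2) (lim0_scale s0 tf))) => h h0.
by rewrite scalerA [s * h]mulrC; field; rewrite h0.
Qed.

Lemma taylor2_near f g x d a b :
  (\forall y \near x, f y = g y) -> taylor2 f x d a b -> taylor2 g x d a b.
Proof.
move=> fg tf e /tf[del del0 fe].
have [del' del'0 fgd] := nbhs_line d fg.
exists (Num.min del del'); first by rewrite lt_min del0.
move=> h h0; rewrite lt_min => /andP[hd hd'].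
by rewrite -(fgd _ hd') -(nbhs_singleton fg); exact: fe.
Qed.

(** Adding the expansions at h and - h removes the first-order term. *)
Lemma taylor2_max f x d a b :
  (\forall y \near x, f y <= f x) -> taylor2 f x d a b -> b <= 0.
Proof.
move=> fmax tf; rewrite leNgt; apply/negP => b0.
have N1 : (-1 : R) != 0 by rewrite oppr_eq0 oner_eq0.
have b20 : 0 < b / 2 + b / 2 by rewrite -mulrDl divr_gt0// addr_gt0.
have [del1 del10 f1] := nbhs_line d fmax.
have [h [h0 hd]] := lim0_gt0_below b20 del10 (lim0D tf (lim0_scale N1 tf)).
have {}hd : `|h| < del1 by rewrite gtr0_norm.
apply/negP; rewrite -leNgt mulN1r sqrrN -mulrDl.
rewrite mulr_le0_ge0 ?invr_ge0 ?sqr_ge0//.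
have := f1 _ hd; have := f1 (- h); rewrite normrN => /(_ hd).
by lra.
Qed.

Definition has_laplacian f x (L : R) := exists a b : 'I_n -> R,
  (forall i, taylor2 f x (delta_mx 0 i) (a i) (b i)) /\ \sum_i b i = L.

Lemma has_laplacian_comb f g x r s (L M : R) :
  has_laplacian f x L -> has_laplacian g x M ->
  has_laplacian (fun y => r * f y + s * g y) x (r * L + s * M).
Proof.
move=> [a [b [tf <-]]] [a' [b' [tg <-]]].
exists (fun i => r * a i + s * a' i), (fun i => r * b i + s * b' i); split.
  by move=> i; exact: taylor2_comb.
by rewrite big_split/= !mulr_sumr.
Qed.

Lemma has_laplacian_near f g x L :
  (\forall y \near x, f y = g y) -> has_laplacian f x L -> has_laplacian g x L.
Proof.
by move=> fg [a [b [tf <-]]]; exists a, b; split=> // i; exact: taylor2_near (tf i).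
Qed.

Lemma has_laplacian_affine f x p s : s != 0 ->
  has_laplacian f (s *: x + p) 0 ->
  has_laplacian (fun y => f (s *: y + p)) x 0.
Proof.
move=> s0 [a [b [tf sb]]].
exists (fun i => s * a i), (fun i => s ^+ 2 * b i); split; last first.
  by rewrite -mulr_sumr sb mulr0.
move=> i.
apply: (@taylor2_subst (fun y => s *: y + p) _ _ _ (s *: delta_mx 0 i)).
  by move=> h; rewrite scalerDr addrAC !scalerA [h * s]mulrC.
exact: taylor2_dirZ.
Qed.

Lemma has_laplacian_dotD x p s : has_laplacian (fun y => dot p y + s) x 0.
Proof.
exists (fun i => p 0 i), (fun=> 0); split; last by rewrite big1.
move=> i; apply: taylor2_quadratic => h.
by rewrite dotDr dotZr dot_delta mul0r mulr0 addr0 addrAC.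
Qed.

Lemma has_laplacian_dotsq p x :
  has_laplacian (fun y => dot (y - p) (y - p)) x (2 * n%:R).
Proof.
exists (fun i => 2 * (x - p) 0 i), (fun=> 2); split; last first.
  by rewrite sumr_const card_ord mulr_natr.
move=> i; apply: taylor2_quadratic => h.
rewrite addrAC; set q := x - p.
rewrite (dotDr (q + _)) (dotZr h (q + _)) dot_delta (dotDl q) (dotC (h *: _) q).
have -> : (q + h *: delta_mx 0 i) 0 i = q 0 i + h.
  by rewrite [LHS]mxE [X in _ + X]mxE [X in h * X]mxE !eqxx mulr1.
by rewrite (dotZr h q) dot_delta; field.
Qed.

Lemma compact_max f (K : set 'rV[R]_n) : compact K -> K !=set0 -> continuous f ->
  exists2 c, K c & forall y, K y -> f y <= f c.
Proof.
move=> cK K0 cf.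
have [|c /set_mem Kc cmax] := @EVT_max_rV R n f K K0 cK.
  exact: continuous_subspaceT.
by exists c => // y Ky; apply: cmax; exact/mem_set.
Qed.

(** Adding a small multiple of |x|^2 makes the Laplacian strictly positive,
    and a function with positive Laplacian has no interior maximum by
    [taylor2_max]. *)
Lemma weak_maximum f (K : set 'rV[R]_n) c :
  (0 < n)%N -> compact K -> continuous f ->
  (forall x, K x -> f x <= c \/ (nbhs x K /\ exists2 L, has_laplacian f x L & 0 <= L)) ->
  forall x, K x -> f x <= c.
Proof.
move=> ngt0 cK cf fK x Kx; rewrite leNgt; apply/negP => cx.
have [q Kq qmax] := compact_max cK (ex_intro _ _ Kx) (@dotsq_continuous R n 0).
pose D := dot (q - 0) (q - 0).
have D0 : 0 <= D := dot_ge0 _.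
have D1 : 0 < D + 1 by rewrite ltr_wpDl.
pose e := (f x - c) / (D + 1).
have e0 : 0 < e by rewrite divr_gt0// subr_gt0.
pose g y := 1 * f y + e * dot (y - 0) (y - 0).
have cg : continuous g.
  by apply: comb_continuous; [exact: cf | exact: dotsq_continuous].
have [z Kz zmax] := compact_max cK (ex_intro _ _ Kx) cg.
have fz : c < f z.
  have := zmax _ Kx; rewrite /g !mul1r => h.
  have eD : e * (D + 1) = f x - c by rewrite divfK// gt_eqF.
  have : e * dot (z - 0) (z - 0) <= e * D by rewrite ler_pM2l//; exact: qmax.
  have : 0 <= e * dot (x - 0) (x - 0) by rewrite mulr_ge0 ?dot_ge0// ltW.
  rewrite mulrDr mulr1 in eD; lra.
case: (fK z Kz) => [|[nK [L lf L0]]]; first by rewrite leNgt fz.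
have [a [b [tb sb]]] := has_laplacian_comb 1 e lf (has_laplacian_dotsq 0 z).
have b0 i : b i <= 0.
  apply: taylor2_max (tb i); apply: filterS nK => y; exact: zmax.
have : \sum_i b i <= 0 by apply: sumr_le0 => i _.
rewrite sb mul1r => h.
have n0 : 0 < n%:R :> R by rewrite ltr0n.
have : 0 < e * (2 * n%:R) by rewrite mulr_gt0// mulr_gt0.
by lra.
Qed.
End Taylor.

(** * From partial derivatives to expansions *)

Section Regularity.
Context {R : realType} {n : nat}.
Implicit Types (f g : 'rV[R]_n -> R) (x y a d p q v : 'rV[R]_n) (r s : R).

(** The vertices of the coordinate path from 0 to v. *)
Definition coord_prefix (k : nat) v : 'rV[R]_n :=
  \row_(j < n) (if (j < k)%N then v 0 j else 0).

Lemma coord_prefix0 v : coord_prefix 0 v = 0.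
Proof. by apply/rowP => j; rewrite !mxE. Qed.

Lemma coord_prefix_full v : coord_prefix n v = v.
Proof. by apply/rowP => j; rewrite !mxE ltn_ord. Qed.

Lemma coord_prefixS (k : 'I_n) v :
  coord_prefix k.+1 v = coord_prefix k v + v 0 k *: delta_mx 0 k.
Proof.
apply/rowP => j; rewrite !mxE eqxx/= ltnS leq_eqVlt.
have [->|jk] := eqVneq j k; first by rewrite eqxx ltnn mulr1 add0r.
by rewrite -[(j : nat) == k]/(j == k) (negPf jk) mulr0 addr0.
Qed.

Lemma norm_prefix_step (k : 'I_n) v s : `|s| <= `|v 0 k| ->
  `|coord_prefix k v + s *: delta_mx 0 k| <= `|v|.
Proof.
move=> sv; apply: norm_le_coord => // j; rewrite !mxE eqxx/=.
have [->|jk] := eqVneq j k.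
  by rewrite ltnn add0r mulr1; apply: le_trans sv _; exact: coord_le_norm.
rewrite mulr0 addr0; case: ifP => _; last by rewrite normr0.
exact: coord_le_norm.
Qed.

(** Telescoping along the coordinate path turns an estimate for increments
    along the axes into one for arbitrary increments. It is used with a a
    gradient, and with a = 0. *)
Lemma coordinate_path f p v a (B : R) :
  (forall k : 'I_n, `|f (p + coord_prefix k v + v 0 k *: delta_mx 0 k)
                     - f (p + coord_prefix k v) - a 0 k * v 0 k| <= B) ->
  `|f (p + v) - f p - dot a v| <= n%:R * B.
Proof.
move=> fB.
have -> : f (p + v) - f p - dot a v = \sum_(k < n)
    (f (p + coord_prefix k v + v 0 k *: delta_mx 0 k)
     - f (p + coord_prefix k v) - a 0 k * v 0 k).
  rewrite sumrB; congr (_ - _).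
  have := telescope_sumr (fun k => f (p + coord_prefix k v)) (leq0n n).
  rewrite coord_prefix0 addr0 coord_prefix_full => <-; rewrite big_mkord.
  by apply: eq_bigr => k _; rewrite coord_prefixS addrA.
apply: le_trans (ler_norm_sum _ _ _) _.
apply: (@le_trans _ _ (\sum_(k < n) B)); first exact: ler_sum.
by rewrite sumr_const card_ord -[leLHS]mulr_natl.
Qed.

(** The mean value theorem between 0 and h, for h of either sign. *)
Lemma mvt_sym (phi phi' : R -> R) (h : R) :
  (forall s, `|s| <= `|h| -> is_derive s 1 phi (phi' s)) ->
  exists2 c, `|c| <= `|h| & phi h - phi 0 = h * phi' c.
Proof.
move=> dphi.
have cphi (a b : R) : (forall s, s \in `[a, b] -> `|s| <= `|h|) ->
    {within `[a, b], continuous phi}.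
  move=> sab; apply: derivable_within_continuous => s /sab/dphi ds.
  exact: ex_derive.
have [h0|h0] := leP 0 h.
  have sab s : s \in `[0, h] -> `|s| <= `|h|.
    by rewrite in_itv/= => /andP[s0 sh]; rewrite !ger0_norm.
  have [|c /sab ch e] := @MVT_segment R phi phi' 0 h h0 _ (cphi _ _ sab).
  by move=> s /subset_itv_oo_cc/sab; exact: dphi.
  by exists c => //; rewrite e subr0 mulrC.
have sab s : s \in `[h, 0] -> `|s| <= `|h|.
  rewrite in_itv/= => /andP[s0 sh].
  by rewrite (ltr0_norm h0) ler0_norm// lerN2.
have [|c /sab ch e] := @MVT_segment R phi phi' h 0 (ltW h0) _ (cphi _ _ sab).
  by move=> s /subset_itv_oo_cc/sab; exact: dphi.
by exists c => //; rewrite -opprB e sub0r mulrN opprK mulrC.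
Qed.

Lemma is_derive_line f p d s : derivable f (p + s *: d) d ->
  is_derive s 1 (fun s => f (p + s *: d)) ('D_d f (p + s *: d)).
Proof.
have lineE : (fun h : R => h^-1 *: (f (p + (h *: 1 + s) *: d) - f (p + s *: d)))
    = (fun h => h^-1 *: (f (h *: d + (p + s *: d)) - f (p + s *: d))).
  apply/funext => h; congr (_ *: (f _ - _)).
  by rewrite [h *: 1]mulr1 scalerDl addrCA.
move=> df; apply: DeriveDef.
  by rewrite /derivable lineE.
by rewrite /derive lineE.
Qed.

(** Strict differentiability: the two points may both vary. This is what lets
    a correction of order h^2 be added to a displacement of order h without
    spoiling a second-order expansion, see [second_order_parabola]. *)
Definition strict_gradient f x a := forall e : R, 0 < e ->
  exists2 del : R, 0 < del &
  forall p q, `|p - x| < del -> `|q - x| < del ->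
    `|f q - f p - dot a (q - p)| <= e * `|q - p|.

Lemma strict_gradient_partial f x :
  (forall i, \forall y \near x, derivable f y (delta_mx 0 i)) ->
  (forall i, {for x, continuous (partial i f)}) ->
  strict_gradient f x (\row_i partial i f x).
Proof.
rewrite /strict_gradient; set a := \row_i _ => df cf e e0.
have n0 : 0 < n%:R + 1 :> R by rewrite ltr_wpDl.
pose e' := e / (n%:R + 1); have e'0 : 0 < e' by rewrite divr_gt0.
have : nbhs x (fun y => forall i, derivable f y (delta_mx 0 i) /\
    `|partial i f y - a 0 i| < e').
  apply: (@filter_forall _ 'I_n (fun i y => derivable f y (delta_mx 0 i) /\
    `|partial i f y - a 0 i| < e') (nbhs x)) => i.
  have /cvgrPdist_lt/(_ _ e'0) ci := cf i.
  near=> y; split; first by near: y; exact: df.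
  by rewrite distrC mxE; near: y; exact: ci.
move=> /nbhs_normP[del /= del0 fdel].
exists (del / 3); first by rewrite divr_gt0.
move=> p q px qx.
have {fdel}fy y : `|y - p| <= `|q - p| -> forall i,
    derivable f y (delta_mx 0 i) /\ `|partial i f y - a 0 i| < e'.
  move=> yp; apply: fdel => /=.
  have := ler_distD p x y; have := ler_distD x q p.
  rewrite (distrC x p) (distrC p y) => h1 h2.
  by rewrite [ltLHS]/=; clear -h1 h2 px qx yp; lra.
have -> : e * `|q - p| = n%:R * (e' * `|q - p|) + e' * `|q - p|.
  by rewrite /e'; field; rewrite gt_eqF.
have {1}-> : q = p + (q - p) by rewrite addrC subrK.
set v := q - p in fy *.
apply: (@le_trans _ _ (n%:R * (e' * `|v|))); last first.
  by rewrite lerDl mulr_ge0// ltW.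
apply: coordinate_path => k.
set y := p + coord_prefix k v.
have yv s : `|s| <= `|v 0 k| -> `|y + s *: delta_mx 0 k - p| <= `|v|.
  by move=> sv; rewrite /y -(addrA p) (addrC p) addrK norm_prefix_step.
have [|c cv /=] := @mvt_sym (fun s => f (y + s *: delta_mx 0 k))
    (fun s => partial k f (y + s *: delta_mx 0 k)) (v 0 k).
  by move=> s sv; apply: is_derive_line; have [] := fy _ (yv _ sv) k.
rewrite scale0r addr0 => ->.
rewrite [a 0 k * _]mulrC -mulrBr normrM mulrC ler_pM//.
  by apply: ltW; have [] := fy _ (yv _ cv) k.
exact: coord_le_norm.
Unshelve. all: by end_near. Qed.

(** The Taylor formula with Peano remainder: the mean value theorem applied to
    f minus its second-order polynomial, whose derivative is o(h). *)
Lemma taylor2_derive f x d :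
  (\forall y \near x, derivable f y d) -> derivable (fun y => 'D_d f y) x d ->
  taylor2 f x d ('D_d f x) ('D_d (fun y => 'D_d f y) x).
Proof.
move=> df ddf e e0.
set g := fun y => 'D_d f y; set b := 'D_d g x.
have [del1 del10 df1] := nbhs_line d df.
have : (fun h : R => h^-1 *: (g (h *: d + x) - g x)) @ (0 : R)^' --> b.
  exact: ddf.
move=> /lim0P/(_ (e / 2) (divr_gt0 e0 (ltr0Sn _ _)))[del2 del20 dg].
exists (Num.min del1 del2); first by rewrite lt_min del10.
move=> h h0; rewrite lt_min => /andP[h1 h2].
pose psi s := f (x + s *: d) - (s * g x + s ^+ 2 * (b / 2)).
have [|c ch psiE] := @mvt_sym psi (fun s => g (x + s *: d) - (g x + s * b)) h.
  move=> s sh.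
  have ds : derivable f (x + s *: d) d by apply: df1; exact: le_lt_trans h1.
  have dl := is_derive_line ds.
  have dq : is_derive s 1 (fun s => s * g x + s ^+ 2 * (b / 2)) (g x + s * b).
    apply: is_derive_eq.
    by rewrite /GRing.scale/=; field.
  exact: is_deriveB.
have -> : f (x + h *: d) - f x - h * g x = psi h - psi 0 + h ^+ 2 * (b / 2).
  by rewrite /psi scale0r addr0; ring.
rewrite mulrDl [h ^+ 2 * _ / _]mulrAC divff ?sqrf_eq0// mul1r addrK.
rewrite psiE.
have gc : `|g (x + c *: d) - (g x + c * b)| <= e / 2 * `|h|.
  have [->|c0] := eqVneq c 0.
    by rewrite scale0r addr0 mul0r addr0 subrr normr0 mulr_ge0// divr_ge0// ltW.
  have := ltW (dg c c0 (le_lt_trans ch h2)).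
  rewrite -(ler_pM2r (_ : 0 < `|c|)) ?normr_gt0// -normrM mulrBl.
  rewrite [_ *: _ * c]mulrAC mulVf// mul1r addrC => le1.
  apply: le_trans (ler_wpM2l _ ch); last by rewrite divr_ge0// ltW.
  move: le1; congr (`|_| <= _).
  by rewrite [c *: d + x]addrC; ring.
rewrite !normrM normfV normrX.
have hn : 0 < `|h| by rewrite normr_gt0.
rewrite ltr_pdivrMr ?exprn_gt0// (le_lt_trans (ler_wpM2l _ gc))//.
have : 0 < e * (`|h| ^+ 2) by rewrite mulr_gt0// exprn_gt0.
by rewrite expr2; lra.
Qed.

(** The second coefficient b is the full coefficient of h^2, without the
    factor 1/2 of [taylor2]: phi need not be the restriction of a function to
    a line. *)
Definition second_order (phi : R -> R) (a b : R) :=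
  lim0 (fun h => (phi h - phi 0 - h * a) / h ^+ 2) b.

Lemma second_order_first phi (a b : R) : second_order phi a b ->
  lim0 (fun h => (phi h - phi 0) / h) a.
Proof.
move=> so; have := lim0D (lim0M (lim0_id) so) (lim0_cst a).
rewrite mul0r add0r; apply: lim0_eq => h h0.
by field.
Qed.

(** The chain rule for g r = r + r^3 / 12: the new coefficients are g' a and
    g' b + g'' a^2 / 2. *)
Lemma second_order_cubic phi (a b : R) : second_order phi a b ->
  second_order (fun h => phi h + phi h ^+ 3 / 12)
    ((1 + phi 0 ^+ 2 / 4) * a)
    ((1 + phi 0 ^+ 2 / 4) * b + phi 0 / 4 * a ^+ 2).
Proof.
move=> so; have fo := second_order_first so.
have := lim0D (lim0D (lim0Z (1 + phi 0 ^+ 2 / 4) so)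
  (lim0Z (phi 0 / 4) (lim0M fo fo)))
  (lim0M (lim0M fo fo) (lim0Z (12^-1) (lim0M lim0_id fo))).
rewrite mul0r !mulr0 addr0 -expr2; apply: lim0_eq => h h0.
by field.
Qed.

Lemma second_order_taylor2 f x d (a b : R) :
  taylor2 f x d a b -> second_order (fun h => f (x + h *: d)) a (b / 2).
Proof. by apply: lim0_eq => h h0; rewrite scale0r addr0. Qed.

Lemma first_order_gradient f x a d : strict_gradient f x a ->
  lim0 (fun h => (f (x + h *: d) - f x) / h) (dot a d).
Proof.
move=> sf e e0.
have d1 : 0 < `|d| + 1 by rewrite ltr_wpDl.
pose e' := e / (`|d| + 1) / 2; have e'0 : 0 < e' by rewrite !divr_gt0.
have [del del0 fdel] := sf _ e'0.
exists (del / (`|d| + 1)); first by rewrite divr_gt0.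
move=> h h0; rewrite ltr_pdivlMr// => hd.
have := fdel x (x + h *: d); rewrite subrr normr0 addrAC subrr add0r.
rewrite normrZ dotZr => /(_ del0) => le1.
have hn : 0 < `|h| by rewrite normr_gt0.
have hdl : `|h| * `|d| < del.
  by apply: le_lt_trans hd; rewrite ler_wpM2l// lerDl.
have -> : (f (x + h *: d) - f x) / h - dot a d =
  (f (x + h *: d) - f x - h * dot a d) / h by field.
rewrite normrM normfV ltr_pdivrMr//.
apply: le_lt_trans (le1 hdl) _.
rewrite mulrCA mulrC ltr_pM2r//.
apply: (@le_lt_trans _ _ (e / 2)); last by lra.
rewrite /e' mulrAC ler_pM2r// mulrAC ler_pdivrMr// ler_pM2l//.
by rewrite lerDl.
Qed.

(** The direction j only enters through a displacement of order h^2, hence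
    through the first derivative. *)
Lemma second_order_parabola f x a b i j (r s : R) : r != 0 ->
  strict_gradient f x a -> taylor2 f x (delta_mx 0 i) (a 0 i) b ->
  second_order
    (fun h => f (x + (r * h) *: delta_mx 0 i + (s * h ^+ 2) *: delta_mx 0 j))
    (r * a 0 i) (r ^+ 2 * b / 2 + s * a 0 j).
Proof.
move=> r0 sf tf.
have tr := second_order_taylor2 (taylor2_dirZ r0 tf).
suff sj : lim0 (fun h => (f (x + (r * h) *: delta_mx 0 i +
    (s * h ^+ 2) *: delta_mx 0 j) - f (x + (r * h) *: delta_mx 0 i)) / h ^+ 2)
    (s * a 0 j).
  apply: (lim0_eq _ (lim0D tr sj)) => h h0.
  rewrite expr0n/= !mulr0 !scale0r !addr0 -mulrDl scalerA [h * r]mulrC.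
  by congr (_ / _); ring.
move=> e e0.
pose e' := e / (`|s| + 1) / 2.
have s1 : 0 < `|s| + 1 by rewrite ltr_wpDl.
have e'0 : 0 < e' by rewrite !divr_gt0.
have [del del0 fdel] := sf _ e'0.
pose K := `|r| + `|s| + 1; have K0 : 0 < K by rewrite ltr_wpDl// addr_ge0.
exists (Num.min 1 (del / K)); first by rewrite lt_min ltr01 divr_gt0.
move=> h h0; rewrite lt_min ltr_pdivlMr// => /andP[h1 hK].
have hn : 0 < `|h| by rewrite normr_gt0.
set p := x + (r * h) *: _; set q := p + _.
have nd (k : R) l : `|k *: (delta_mx 0 l : 'rV[R]_n)| <= `|k|.
  by rewrite normrZ ler_piMr// norm_delta.
have px : `|p - x| <= `|r| * `|h|.
  by rewrite /p addrAC subrr add0r -normrM nd.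
have qp : `|q - p| <= `|s| * `|h| ^+ 2.
  by rewrite /q addrAC subrr add0r -normrX -normrM nd.
have hh : `|h| ^+ 2 <= `|h| by rewrite expr2 ler_piMl// ltW.
have shh : `|s| * `|h| ^+ 2 <= `|s| * `|h| by rewrite ler_wpM2l.
have hK' : `|r| * `|h| + `|s| * `|h| + `|h| < del.
  by move: hK; rewrite /K mulrC !mulrDl mul1r.
have pd : `|p - x| < del.
  have : 0 <= `|s| * `|h| by rewrite mulr_ge0.
  by clear -px hK' hn; lra.
have qd : `|q - x| < del.
  have := ler_distD p q x.
  by clear -px qp shh hK' hn; lra.
have := fdel p q pd qd.
have -> : dot a (q - p) = s * h ^+ 2 * a 0 j.
  by rewrite /q addrAC subrr add0r dotZr dot_delta.
move=> le1.
have h2 : 0 < `|h ^+ 2| by rewrite normr_gt0 expf_neq0.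
have -> : (f q - f p) / h ^+ 2 - s * a 0 j =
    (f q - f p - s * h ^+ 2 * a 0 j) / h ^+ 2 by field.
rewrite normrM normfV ltr_pdivrMr//.
apply: le_lt_trans le1 _.
apply: (@le_lt_trans _ _ (e' * (`|s| * `|h| ^+ 2))).
  by rewrite ler_wpM2l// ltW.
rewrite mulrA normrX ltr_pM2r; last by rewrite -normrX.
apply: (@le_lt_trans _ _ (e / 2)); last by clear -e0; lra.
rewrite /e' mulrAC ler_pM2r// mulrAC ler_pdivrMr// ler_pM2l//.
by rewrite lerDl.
Qed.
End Regularity.

(** * Convex bodies and half-spaces *)

Section Bodies.
Context {R : realType} {n : nat}.
Implicit Types (f : 'rV[R]_n -> R) (C : set 'rV[R]_n) (x y p q N : 'rV[R]_n).

Lemma closed_le_continuous f r : continuous f -> closed [set y | f y <= r].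
Proof.
move=> cf; apply: (@preimage_closed _ _ f [set t : R | t <= r]).
  by move=> y _; exact: cf.
exact: closed_le.
Qed.

Lemma compact_ball_norm r : compact [set y : 'rV[R]_n | `|y| <= r].
Proof.
apply: bounded_closed_compact; last first.
  by apply: closed_le_continuous; exact: norm_continuous.
by exists r; split=> [|M rM y /= yr]; [exact: num_real | apply: le_trans yr (ltW rM)].
Qed.

Lemma ball_norm_interior x r : `|x| < r -> nbhs x [set y | `|y| <= r].
Proof.
move=> xr; apply/nbhs_delta; exists (r - `|x|); first by rewrite subr_gt0.
move=> z; rewrite ltrBrDr => zr; apply: ltW; apply: le_lt_trans zr.
by rewrite -{1}(subrK x z) ler_normD.
Qed.

Definition convex_body C :=
  compact C /\ (forall x y (t : R), C x -> C y -> 0 <= t <= 1 ->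
    C (t *: x + (1 - t) *: y)).

(** The hyperplane through the point p of C nearest to x for the Euclidean
    distance, orthogonal to x - p. The normal is scaled in the sup norm, so
    that the affine function N.x - beta bounds the distance to p from above.
    *)
Lemma separation C x : convex_body C -> C !=set0 -> ~ C x ->
  exists N beta, [/\ `|N| <= 1, forall y, C y -> dot N y <= beta &
    exists2 p, C p & `|x - p| <= dot N x - beta].
Proof.
move=> [cC convC] C0 Cx.
have [p Cp pmin] : exists2 p, C p & forall y, C y ->
    dot (p - x) (p - x) <= dot (y - x) (y - x).
  have [|p Cp pmin] := compact_max cC C0 (f := fun y => - dot (y - x) (y - x)).
    by move=> y; exact: (cvgN (@dotsq_continuous R n x y)).
  by exists p => // y /pmin; rewrite lerN2.
pose d := x - p.
have d0 : d != 0.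
  by apply/eqP => /eqP; rewrite subr_eq0 => /eqP e; apply: Cx; rewrite e.
have dn : 0 < `|d| by rewrite normr_gt0.
have var y : C y -> dot d y <= dot d p.
  move=> Cy; rewrite -subr_le0 -dotNr -dotDr leNgt; apply/negP => pos.
  pose D := dot (y - p) (y - p).
  have D0 : 0 <= D := dot_ge0 _.
  (* This t makes t D smaller than 2 d.(y - p), so that the point t y + (1
     - t) p of C is nearer to x than p. *)
  pose t := Num.min 1 (dot d (y - p) / (D + 1)).
  have D1 : 0 < D + 1 by rewrite ltr_wpDl.
  have t0 : 0 < t by rewrite lt_min ltr01 divr_gt0.
  have t1 : t <= 1 by rewrite ge_min lexx.
  have tD : t * (D + 1) <= dot d (y - p).
    by rewrite -ler_pdivlMr// ge_min lexx orbT.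
  have := pmin _ (convC y p t Cy Cp _); rewrite ltW// t1 => /(_ isT).
  have -> : t *: y + (1 - t) *: p - x = t *: (y - p) - d.
    by apply/rowP => i; rewrite !mxE; ring.
  have -> : p - x = - d by rewrite opprB.
  set q := y - p; rewrite -/q in pos tD.
  have -> : dot (t *: q - d) (t *: q - d) = t * (t * D - 2 * dot d q) + dot d d.
    rewrite dotDl (dotDr (t *: q)) (dotDr (- d)) !dotNl !dotNr !dotZl !dotZr.
    by rewrite (dotC q d) /D; ring.
  rewrite dotNl dotNr opprK; set G := dot d q in pos tD *.
  set dd := dot d d => le1.
  have le2 : 0 <= t * (t * D - 2 * G) by clear -le1; lra.
  have le3 : 0 <= t * D - 2 * G by rewrite -(pmulr_rge0 _ t0).
  by move: tD; clear -le3 t0 pos; lra.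
exists (`|d|^-1 *: d), (dot (`|d|^-1 *: d) p); split.
- by rewrite normrZ normfV normr_id mulVf// gt_eqF.
- by move=> y /var le1; rewrite !dotZl ler_pM2l// invr_gt0.
- exists p => //; rewrite -dotNr -dotDr -/d dotZl mulrC ler_pdivlMr//.
  by rewrite -expr2 normsq_le_dot.
Qed.

End Bodies.

(** * Harmonic functions and capacitary potentials *)

(** The diagonal second derivatives b have sum 0; no mixed derivative is
    recorded. *)
Definition harmonic_at {R : realType} {n : nat} (f : 'rV[R]_n -> R) x :=
  exists a b, [/\ strict_gradient f x a,
    forall i, taylor2 f x (delta_mx 0 i) (a 0 i) (b i) &
    \sum_(i < n) b i = 0].

Lemma harmonic_has_laplacian (R : realType) (n : nat) (f : 'rV[R]_n -> R) x :
  harmonic_at f x -> has_laplacian f x 0.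
Proof. by move=> [a [b [_ tf sb]]]; exists (fun i => a 0 i), b. Qed.

Definition capacitary {R : realType} {n : nat} (C : set 'rV[R]_n)
    (v : 'rV[R]_n -> R) :=
  [/\ continuous v, forall x, C x -> v x = 1,
      forall x, ~ C x -> harmonic_at v x & tends_to_at_infinity v 0].

(** * Finite differences of harmonic functions *)

Section Differences.
Context {R : realType} {n : nat}.
Hypothesis n0 : (0 < n)%N.
Implicit Types (f w : 'rV[R]_n -> R) (x y p q u : 'rV[R]_n) (i j : 'I_n).

Let n1 : 1 <= n%:R :> R. Proof. by rewrite ler1n. Qed.

(** The reflection in the hyperplane orthogonal to the i-th axis through p. *)
Definition mirror p i x : 'rV[R]_n := x - (2 * (x - p) 0 i) *: delta_mx 0 i.

Lemma mirror_coord p i x j :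
  (mirror p i x - p) 0 j = if j == i then - (x - p) 0 j else (x - p) 0 j.
Proof.
rewrite !mxE eqxx/=; case: eqVneq => [->|ji].
  by rewrite mulr1; ring.
by rewrite mulr0 oppr0 addr0.
Qed.

Lemma norm_mirror p i x : `|mirror p i x - p| <= `|x - p|.
Proof.
apply: norm_le_coord => // j; rewrite mirror_coord.
by case: ifP => _; rewrite ?normrN coord_le_norm.
Qed.

Lemma mirror_continuous p i : continuous (mirror p i).
Proof.
move=> x; have c : (fun y => 2 * (y - p) 0 i) @ x --> 2 * (x - p) 0 i.
  have h : (fun y => y - p) @ x --> x - p by exact: (cvgB cvg_id (cvg_cst _)).
  have k := cvg_comp _ _ h (@coord_continuousR R n i (x - p)).
  exact: (cvgMr k).
exact: (cvgB cvg_id (cvgZr_tmp c)).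
Qed.

Lemma has_laplacian_mirror f p i x : has_laplacian f (mirror p i x) 0 ->
  has_laplacian (fun y => f (mirror p i y)) x 0.
Proof.
move=> [a [b [tf sb]]]; exists (fun j => (if j == i then -1 else 1) * a j), b.
split=> // j; set s := if _ then _ else _.
have s0 : s != 0 by rewrite /s; case: ifP; rewrite ?oppr_eq0 oner_eq0.
have s2 : s ^+ 2 = 1 by rewrite /s; case: ifP; rewrite ?sqrrN expr1n.
apply: (@taylor2_subst _ _ (mirror p i) _ _ _ (s *: delta_mx 0 j)).
  move=> h; apply/rowP => k; rewrite !mxE eqxx/= /s.
  case: (eqVneq j i) => [->|ji]; case: (eqVneq k i) => [->|ki].
  - by rewrite /= mulr1n; ring.
  - by rewrite /= mulr1n mulr0n; ring.
  - by rewrite eq_sym (negPf ji) /= mulr1n mulr0n; ring.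
  - by rewrite /= mulr0n; ring.
by rewrite -[b j]mul1r -s2; exact: taylor2_dirZ.
Qed.

Lemma has_laplacian_parabola p i (d : R) x :
  has_laplacian (fun y => (y - p) 0 i * (d - (y - p) 0 i)) x (-2).
Proof.
pose k (j : 'I_n) : R := (j == i)%:R.
exists (fun j => k j * (d - 2 * (x - p) 0 i)), (fun j => k j * -2); split.
  move=> j; apply: taylor2_quadratic => h.
  have -> : (x + h *: delta_mx 0 j - p) 0 i = (x - p) 0 i + h * k j.
    by rewrite !mxE eqxx/= /k eq_sym; ring.
  rewrite /k; case: (j == i); last by rewrite !mul0r !mulr0 !addr0.
  by rewrite /= mulr1n; field.
rewrite (bigD1 i)//= {1}/k eqxx mul1r big1 ?addr0// => j ji.
by rewrite /k (negPf ji) mul0r.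
Qed.

(** The function w minus its mirror image vanishes on the hyperplane of
    symmetry and is at most 2 M on the cube.  With y = x - p, it is compared on
    the half cube y_i >= 0 with the polynomial
    2 M (y.y + n y_i (d - y_i)) / d^2, which is harmonic, nonnegative where
    y_i = 0, and at least 2 M where |y| = d because y.y >= |y|^2. *)
Lemma half_cube w p i (d M s : R) : continuous w -> 0 < d ->
  (forall x, `|x - p| <= d -> has_laplacian w x 0) ->
  (forall x, `|x - p| <= d -> `|w x| <= M) -> 0 <= s <= d ->
  w (p + s *: delta_mx 0 i) - w (p - s *: delta_mx 0 i) <= 2 * n%:R * M * s / d.
Proof.
move=> cw d0 lw wM /andP[s0 sd].
have M0 : 0 <= M.
  by apply: le_trans (wM p _) => //; rewrite subrr normr0 ltW.
pose q y := (y - p) 0 i * (d - (y - p) 0 i).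
pose c := - (2 * M / d ^+ 2).
have c0 : 0 <= 2 * M / d ^+ 2 by rewrite divr_ge0 ?mulr_ge0 ?exprn_ge0// ltW.
pose f y := 1 * (1 * w y + -1 * w (mirror p i y)) +
   c * (1 * dot (y - p) (y - p) + n%:R * q y).
pose K := [set y : 'rV[R]_n | `|y - p| <= d] `&` [set y | - (y - p) 0 i <= 0].
have csub : continuous (fun y => y - p : 'rV[R]_n).
  by move=> y; exact: (cvgB cvg_id (cvg_cst _)).
have cnorm : continuous (fun y : 'rV[R]_n => `|y - p|).
  by move=> y; exact: (cvg_norm (csub y)).
have ci : continuous (fun y => (y - p) 0 i).
  by move=> y; exact: (cvg_comp _ _ (csub y) (@coord_continuousR R n i (y - p))).
have cr : continuous (fun y => w (mirror p i y)).
  by move=> y; exact: (cvg_comp _ _ (@mirror_continuous p i y) (cw _)).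
have cq : continuous q.
  by move=> y; exact: (cvgM (ci y) (cvgB (cvg_cst d) (ci y))).
have cf : continuous f.
  apply: comb_continuous; apply: comb_continuous => //.
  exact: dotsq_continuous.
have cK : compact K.
  have closedK : closed K.
    apply: closedI; apply: closed_le_continuous => //.
    by move=> y; exact: (cvgN (ci y)).
  apply: (@subclosed_compact _ K _ closedK (@compact_ball_norm R n (d + `|p|))).
  move=> y [/= yd _].
  by rewrite -(subrK p y) (le_trans (ler_normD _ _))// lerD2r.
have KP y : K y -> f y <= 0 \/ (nbhs y K /\ exists2 L, has_laplacian f y L & 0 <= L).
  move=> [/= yd]; rewrite oppr_le0 => yi.
  have yid : (y - p) 0 i <= d.
    by apply: le_trans yd; rewrite (le_trans (ler_norm _))// coord_le_norm.
  have q0 : 0 <= q y by rewrite mulr_ge0// subr_ge0.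
  have [yi0|yi0] := leP ((y - p) 0 i) 0.
    left; have e : (y - p) 0 i = 0 by apply/eqP; rewrite eq_le yi0 yi.
    rewrite /f /mirror /q e mulr0 scale0r subr0 mul0r mulr0.
    have := dot_ge0 (y - p); set D := dot _ _ => D0.
    have : 0 <= 2 * M / d ^+ 2 * D by rewrite mulr_ge0.
    by rewrite /c; lra.
  have [yd'|yd'] := leP d `|y - p|.
    left; have D0 : d ^+ 2 <= dot (y - p) (y - p).
      by apply: le_trans (normsq_le_dot _); rewrite ler_sqr ?nnegrE// ltW.
    have w1 := wM y yd; have w2 := wM _ (le_trans (norm_mirror p i y) yd).
    have {}w1 : w y <= M := le_trans (ler_norm _) w1.
    have {}w2 : - w (mirror p i y) <= M.
      by rewrite (le_trans (ler_norm _))// normrN.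
    have : 2 * M / d ^+ 2 * d ^+ 2 <= 2 * M / d ^+ 2 * (dot (y - p) (y - p) + n%:R * q y).
      by rewrite ler_wpM2l// ler_wpDr// mulr_ge0.
    rewrite divfK ?expf_neq0 ?gt_eqF// => le1.
    by rewrite /f /c !mul1r; lra.
  right; split.
    apply: filterI.
      apply/nbhs_delta; exists (d - `|y - p|); first by rewrite subr_gt0.
      move=> z; rewrite ltrBrDr => zy; apply: ltW; apply: le_lt_trans zy.
      exact: ler_distD.
    apply: filterS (nbhs_gt_continuous ci yi0) => z /= /ltW.
    by rewrite oppr_le0.
  exists (1 * (1 * 0 + -1 * 0) + c * (1 * (2 * n%:R) + n%:R * -2)); last by lra.
  apply: has_laplacian_comb; apply: has_laplacian_comb.
  - exact: lw.
  - by apply: has_laplacian_mirror; apply: lw; exact: le_trans (norm_mirror _ _ _) yd.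
  - exact: has_laplacian_dotsq.
  - exact: has_laplacian_parabola.
pose x := p + s *: (delta_mx 0 i : 'rV[R]_n).
have xp : x - p = s *: delta_mx 0 i by rewrite /x addrAC subrr add0r.
have xi : (x - p) 0 i = s by rewrite xp !mxE !eqxx mulr1.
have := weak_maximum n0 cK cf KP (x := x).
rewrite /f /q xi /mirror xi xp dotZr dot_delta !mxE !eqxx mulr1 mul1r.
have -> : x - (2 * s) *: delta_mx 0 i = p - s *: delta_mx 0 i.
  by apply/rowP => k; rewrite !mxE; ring.
rewrite /K/= xi xp => h.
have Kx : `|s *: (delta_mx 0 i : 'rV[R]_n)| <= d /\ - s <= 0.
  split; last by rewrite oppr_le0.
  rewrite normrZ ger0_norm//; apply: le_trans sd.
  by rewrite ler_piMr// norm_delta.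
have {h} := h Kx; rewrite -/x => h.
have b : 1 * (s * s) + n%:R * (s * (d - s)) <= n%:R * s * d.
  have : 0 <= (n%:R - 1) * (s * s) by rewrite mulr_ge0 ?subr_ge0 ?mulr_ge0.
  by lra.
have : 2 * M / d ^+ 2 * (1 * (s * s) + n%:R * (s * (d - s))) <=
  2 * M / d ^+ 2 * (n%:R * s * d) by rewrite ler_wpM2l.
have -> : 2 * M / d ^+ 2 * (n%:R * s * d) = 2 * n%:R * M * s / d.
  by field; rewrite gt_eqF.
by move: h; rewrite /c; lra.
Qed.

Lemma half_cube_abs w p i (d M s : R) : continuous w -> 0 < d ->
  (forall x, `|x - p| <= d -> has_laplacian w x 0) ->
  (forall x, `|x - p| <= d -> `|w x| <= M) -> `|s| <= d ->
  `|w (p + s *: delta_mx 0 i) - w (p - s *: delta_mx 0 i)|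
    <= 2 * n%:R * M * `|s| / d.
Proof.
move=> cw d0 lw wM sd.
wlog s0 : s sd / 0 <= s => [H|].
  have [|/ltW s0] := leP 0 s; first exact: H.
  have := H (- s); rewrite normrN oppr_ge0 => /(_ sd s0).
  by rewrite !scaleNr opprK distrC.
rewrite ger0_norm// in sd *.
rewrite ler_norml lerNl opprB; apply/andP; split; last first.
  by apply: half_cube => //; rewrite s0.
pose w' x := -1 * w x + 0 * w x.
have -> : w (p - s *: delta_mx 0 i) - w (p + s *: delta_mx 0 i) =
  w' (p + s *: delta_mx 0 i) - w' (p - s *: delta_mx 0 i) by rewrite /w'; ring.
apply: half_cube => // [|x xp|x xp|]; last by rewrite s0.
- exact: comb_continuous.
- have -> : 0 = -1 * 0 + 0 * 0 :> R by ring.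
  by apply: has_laplacian_comb; exact: lw.
- have -> : w' x = - w x by rewrite /w'; ring.
  by rewrite normrN; exact: wM.
Qed.

(** The coordinate path is used with [half_cube_abs] centred at the middle of
    each of its edges. *)
Lemma harmonic_difference w y u (d M : R) :
  continuous w -> 0 < d -> `|u| <= 2 * d ->
  (forall x, `|x - y| <= `|u| + d -> has_laplacian w x 0) ->
  (forall x, `|x - y| <= `|u| + d -> `|w x| <= M) ->
  `|w (y + u) - w y| <= n%:R ^+ 2 * M * `|u| / d.
Proof.
move=> cw d0 ud lw wM.
have M0 : 0 <= M.
  by apply: le_trans (wM y _) => //; rewrite subrr normr0 addr_ge0// ltW.
have -> : n%:R ^+ 2 * M * `|u| / d = n%:R * (n%:R * M * `|u| / d).
  by field; rewrite gt_eqF.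
have -> : w (y + u) - w y = w (y + u) - w y - dot 0 u by rewrite dot0l subr0.
apply: coordinate_path => k; rewrite mxE mul0r subr0.
set P := y + coord_prefix k u; set c := u 0 k.
pose p := P + (c / 2) *: delta_mx 0 k.
have cu : `|c| <= `|u| := coord_le_norm u k.
have py : `|p - y| <= `|u|.
  rewrite /p /P -(addrA y) (addrC y) addrK norm_prefix_step//.
  by rewrite normrM normfV (ger0_norm (ler0n R 2)) -/c; have := normr_ge0 c; lra.
have inball x : `|x - p| <= d -> `|x - y| <= `|u| + d.
  by move=> xp; have := ler_distD p x y; lra.
have lwp x : `|x - p| <= d -> has_laplacian w x 0 by move=> /inball/lw.
have wMp x : `|x - p| <= d -> `|w x| <= M by move=> /inball/wM.
have -> : P + c *: delta_mx 0 k = p + (c / 2) *: delta_mx 0 k.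
  by apply/rowP => l; rewrite !mxE; field.
have -> : w P = w (p - (c / 2) *: delta_mx 0 k) by rewrite /p addrK.
have c2 : `|c / 2| = `|c| / 2 by rewrite normrM normfV (ger0_norm (ler0n R 2)).
apply: le_trans (half_cube_abs k cw d0 lwp wMp _) _; first by rewrite c2; lra.
rewrite c2 ler_pM2r ?invr_gt0//.
have -> : 2 * n%:R * M * (`|c| / 2) = n%:R * M * `|c| by field.
by rewrite ler_wpM2l// mulr_ge0.
Qed.

Definition fdiff u f x := f (x + u) - f x.

(** The differences of a harmonic function are harmonic on a smaller cube;
    each difference costs 2 eta of the radius, and gains a factor n^2 |u| /
    eta by [harmonic_difference]. *)
Lemma fdiff_iterated w q u (rho eta : R) :
  continuous w -> 0 < eta -> `|u| <= eta ->
  (forall x, `|x - q| <= rho -> has_laplacian w x 0) ->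
  (forall x, `|x - q| <= rho -> `|w x| <= 1) ->
  forall k, [/\ continuous (iter k (fdiff u) w),
    forall x, `|x - q| <= rho - k%:R * (2 * eta) ->
      has_laplacian (iter k (fdiff u) w) x 0 &
    forall x, `|x - q| <= rho - k%:R * (2 * eta) ->
      `|iter k (fdiff u) w x| <= (n%:R ^+ 2 * `|u| / eta) ^+ k].
Proof.
move=> cw eta0 ue lw w1; elim=> [|k [cf lf fb]].
  by split=> // x; rewrite mul0r subr0; [exact: lw | rewrite expr0; exact: w1].
have sub x y : `|x - q| <= rho - k.+1%:R * (2 * eta) -> `|y - x| <= 2 * eta ->
    `|y - q| <= rho - k%:R * (2 * eta).
  by have := ler_distD x y q; rewrite -natr1; lra.
split=> /=.
- move=> x; have c1 : continuous (fun x => iter k (fdiff u) w (x + u)).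
    move=> y; have h : (fun y => y + u) @ y --> y + u.
      exact: (cvgD cvg_id (cvg_cst _)).
    exact: (cvg_comp _ _ h (cf _)).
  exact: (cvgB (c1 x) (cf x)).
- move=> x xq; rewrite /fdiff.
  have l1 : has_laplacian (fun y => iter k (fdiff u) w (1 *: y + u)) x 0.
    apply: has_laplacian_affine; first exact: oner_neq0.
    by apply: lf; apply: (sub x) => //; rewrite scale1r addrC addKr; lra.
  have l2 : has_laplacian (iter k (fdiff u) w) x 0.
    by apply: lf; apply: (sub x) => //; rewrite subrr normr0; lra.
  have := has_laplacian_comb 1 (-1) l1 l2.
  have -> : 1 * 0 + -1 * 0 = 0 :> R by ring.
  apply: has_laplacian_near; near=> y.
  by rewrite mul1r mulN1r scale1r.
- move=> x xq; rewrite /fdiff exprS.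
  have -> : n%:R ^+ 2 * `|u| / eta * (n%:R ^+ 2 * `|u| / eta) ^+ k =
    n%:R ^+ 2 * (n%:R ^+ 2 * `|u| / eta) ^+ k * `|u| / eta by ring.
  apply: harmonic_difference => //; first lra.
    by move=> y yx; apply: lf; apply: (sub x) => //; lra.
  by move=> y yx; apply: fb; apply: (sub x) => //; lra.
Unshelve. all: by end_near. Qed.

(** Discrete integration, k times: each summation at most doubles the bound
    from one point of the progression to the next. *)
Lemma fdiff_vanishing f b u (G : R) (N k : nat) : 0 <= G ->
  (forall j : nat, (j < k)%N -> f (b + u *+ j) = 0) ->
  (forall j : nat, (j <= N)%N -> `|iter k (fdiff u) f (b + u *+ j)| <= G) ->
  forall j : nat, (j <= N)%N -> `|f (b + u *+ j)| <= G * 2 ^+ j.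
Proof.
move=> G0; elim: k f => [|k IH] f f0 fG j jN.
  by apply: le_trans (fG j jN) _; rewrite ler_peMr// exprn_ege1// ler1n.
have Df := IH (fdiff u f).
have {}Df : forall j : nat, (j <= N)%N -> `|fdiff u f (b + u *+ j)| <= G * 2 ^+ j.
  apply: Df => [l lk|l lN]; last by rewrite -iterSr; exact: fG.
  rewrite /fdiff -addrA -mulrSr !f0 ?subrr//.
  exact: ltnW.
elim: j jN => [|j IHj] jN.
  by rewrite f0// normr0 mulr_ge0.
have jN' : (j <= N)%N by exact: ltnW.
rewrite mulrSr addrA -(subrK (f (b + u *+ j)) (f _)).
rewrite exprS mulrCA mulr_natl mulr2n.
apply: le_trans (ler_normD _ _) _; rewrite lerD//; last exact: IHj.
exact: Df.
Qed.

Lemma le_geometric_eq0 (a : R) :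
  (forall k : nat, (0 < k)%N -> `|a| <= 2^-1 ^+ k) -> a = 0.
Proof.
move=> ak; apply/eqP; rewrite -normr_le0 leNgt; apply/negP => a0.
have [N aN] : exists N : nat, `|a|^-1 < N%:R.
  by exists (Num.bound `|a|^-1); apply: archi_boundP; rewrite invr_ge0.
have N0 : (0 < N)%N by rewrite -(ltr_nat R); apply: le_lt_trans aN; rewrite invr_ge0 ltW.
have := ak N N0; apply/negP; rewrite -ltNge.
rewrite exprVn invf_plt ?posrE ?exprn_gt0//.
by apply: lt_trans aN _; rewrite -natrX ltr_nat ltn_expl.
Qed.

(** Take k + k steps of length del / k from y - del e to y + del e. The first
    k points are zeros of w. With eta = rho / (4 k) the k-th difference is at
    most 8^-k on the cube of radius rho / 2, so that |w (y + del e)| <= 8^-k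
    4^k for every k. *)
Lemma harmonic_continuation w y e (rho del : R) : continuous w -> 0 < rho ->
  (forall x, `|x - y| <= rho -> has_laplacian w x 0) ->
  (forall x, `|x - y| <= rho -> `|w x| <= 1) ->
  0 < del -> 32 * n%:R ^+ 2 * del * `|e| <= rho ->
  (forall s, 0 <= s <= del -> w (y - s *: e) = 0) -> w (y + del *: e) = 0.
Proof.
move=> cw rho0 lw w1 del0 small w0; apply: le_geometric_eq0 => k k0.
have kR : 0 < k%:R :> R by rewrite ltr0n.
pose u := (del / k%:R) *: e; pose b := y - del *: e.
have nu : `|u| = del * `|e| / k%:R.
  by rewrite normrZ gtr0_norm ?divr_gt0// mulrAC.
have de0 : 0 <= del * `|e| by rewrite mulr_ge0// ltW.
have nn : 1 <= n%:R ^+ 2 :> R by rewrite exprn_ege1.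
have de : 32 * (del * `|e|) <= rho.
  have : 0 <= (n%:R ^+ 2 - 1) * (del * `|e|) by rewrite mulr_ge0// subr_ge0.
  by move: small; lra.
pose eta := rho / (4 * k%:R).
have eta0 : 0 < eta by rewrite divr_gt0// mulr_gt0.
have ue : `|u| <= eta.
  rewrite nu /eta invfM mulrA ler_pM2r ?invr_gt0//; lra.
have [_ _ bound] := fdiff_iterated cw eta0 ue lw w1 k.
have bu (j : nat) : b + u *+ j = y + (del * (j%:R / k%:R - 1)) *: e.
  by rewrite /b /u -scaler_nat; apply/rowP => i; rewrite !mxE; field; rewrite gt_eqF.
have -> : y + del *: e = b + u *+ k.*2.
  rewrite bu -muln2 natrM; congr (_ + _ *: _).
  by field; rewrite gt_eqF.
pose G := (n%:R ^+ 2 * `|u| / eta) ^+ k.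
have G8 : n%:R ^+ 2 * `|u| / eta <= 8^-1.
  have -> : n%:R ^+ 2 * `|u| / eta = 4 * (n%:R ^+ 2 * del * `|e|) / rho.
    by rewrite nu /eta; field; rewrite !gt_eqF.
  by rewrite ler_pdivrMr//; lra.
have g0 : 0 <= n%:R ^+ 2 * `|u| / eta by rewrite divr_ge0 ?mulr_ge0 ?exprn_ge0// ltW.
have G0 : 0 <= G by rewrite exprn_ge0.
apply: le_trans (fdiff_vanishing (k := k) G0 _ _ (leqnn k.*2)) _.
- move=> j jk; rewrite bu; have -> : y + (del * (j%:R / k%:R - 1)) *: e =
    y - (del * (1 - j%:R / k%:R)) *: e by apply/rowP => i; rewrite !mxE; ring.
  have jk1 : j%:R / k%:R <= 1 :> R by rewrite ler_pdivrMr// mul1r ler_nat ltnW.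
  have jk0 : 0 <= j%:R / k%:R :> R by rewrite divr_ge0.
  by apply: w0; rewrite mulr_ge0 ?subr_ge0// ?(ltW del0)//= ler_piMr ?(ltW del0)//; lra.
- move=> j j2k; apply: bound; rewrite bu addrC addKr normrZ normrM (gtr0_norm del0).
  have -> : rho - k%:R * (2 * eta) = rho / 2 by rewrite /eta; field; rewrite gt_eqF.
  have jk1 : j%:R / k%:R <= 2 :> R.
    by rewrite ler_pdivrMr// -natrM ler_nat mul2n.
  have jk0 : 0 <= j%:R / k%:R :> R by rewrite divr_ge0.
  have a1 : `|j%:R / k%:R - 1| <= 1 :> R by rewrite ler_norml; apply/andP; split; lra.
  have : del * `|j%:R / k%:R - 1| * `|e| <= del * `|e|.
    by rewrite mulrAC ler_piMr.
  by lra.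
- rewrite -muln2 mulnC exprM /G -exprMn.
  have g4 : 0 <= n%:R ^+ 2 * `|u| / eta * 2 ^+ 2 by rewrite mulr_ge0// exprn_ge0.
  rewrite lerXn2r ?nnegrE//.
  by move: G8; lra.
Qed.

End Differences.

(** * Two tools for the concavity maximum principle *)

Section Cubic.
Context {R : realType}.
Implicit Types (r s : R).

Definition cubic r := r + r ^+ 3 / 12.

Lemma cubic_lt r s : (cubic r < cubic s) = (r < s).
Proof.
have inc a b : a < b -> cubic a < cubic b.
  move=> ab; rewrite -subr_gt0 /cubic.
  have -> : b + b ^+ 3 / 12 - (a + a ^+ 3 / 12) =
     (b - a) * (1 + ((a + b / 2) ^+ 2 + 3 * (b / 2) ^+ 2) / 12) by field.
  rewrite mulr_gt0 ?subr_gt0// ltr_pwDl// divr_ge0// addr_ge0 ?sqr_ge0//.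
  by rewrite mulr_ge0 ?sqr_ge0.
apply/idP/idP => [|/inc//]; apply: contraTT.
by rewrite -!leNgt le_eqVlt => /predU1P[->|/inc/ltW].
Qed.

Lemma cubic_le r s : (cubic r <= cubic s) = (r <= s).
Proof. by rewrite !leNgt cubic_lt. Qed.

(** For g = [cubic] the function compared here is g'' / g'^2, the factor
    between the Laplacian of g v and the squared gradient of g v when v is
    harmonic. *)
Lemma cubic_ratio_lt r s : 0 <= r -> r < s -> s <= 1 ->
  (r / 2) / (1 + r ^+ 2 / 4) ^+ 2 < (s / 2) / (1 + s ^+ 2 / 4) ^+ 2.
Proof.
move=> r0 rs s1.
have pos a : 0 < (1 + a ^+ 2 / 4) ^+ 2 :> R.
  by rewrite exprn_gt0// ltr_wpDr// divr_ge0// sqr_ge0.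
rewrite ltr_pdivrMr// mulrAC ltr_pdivlMr// -subr_gt0.
have -> : s / 2 * (1 + r ^+ 2 / 4) ^+ 2 - r / 2 * (1 + s ^+ 2 / 4) ^+ 2 =
  (s - r) / 2 * (1 - r * s / 2 - r * s * (r ^+ 2 + r * s + s ^+ 2) / 16) by field.
have s0 : 0 < s by exact: le_lt_trans rs.
have r1 : r <= 1 by lra.
rewrite mulr_gt0 ?divr_gt0 ?subr_gt0//.
have rs1 : r * s <= 1 by rewrite -[leRHS]mul1r ler_pM// ltW.
have rs0 : 0 <= r * s by rewrite mulr_ge0// ltW.
have r21 : r ^+ 2 <= 1 by rewrite -[leRHS]mul1r expr2 ler_pM.
have s21 : s ^+ 2 <= 1 by rewrite -[leRHS]mul1r expr2 ler_pM// ltW.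
have : r * s * (r ^+ 2 + r * s + s ^+ 2) <= 1 * 3.
  by rewrite ler_pM ?addr_ge0 ?sqr_ge0//; lra.
lra.
Qed.

Lemma lim0_cubic (phi : R -> R) a : lim0 (fun h => (phi h - phi 0) / h) a ->
  lim0 (fun h => (cubic (phi h) - cubic (phi 0)) / h) ((1 + phi 0 ^+ 2 / 4) * a).
Proof.
move=> fo.
have := lim0D (lim0Z (1 + phi 0 ^+ 2 / 4) fo)
  (lim0M (lim0M lim0_id (lim0M fo fo)) (lim0D (lim0_cst (phi 0 / 4))
     (lim0Z (12^-1) (lim0M lim0_id fo)))).
rewrite !mul0r addr0; apply: lim0_eq => h h0.
by rewrite /cubic; field.
Qed.

End Cubic.

Section Parallel.
Context {R : realType} {n : nat}.
Implicit Types (A B D p q : 'rV[R]_n) (t : R).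

(** The hypothesis says that no p, q increase A.p and B.q beyond D.(t p + (1 -
    t) q). Taking t p + (1 - t) q = 0 it shows that no direction has A.p > 0 >
    B.p, so that B is a positive multiple k of A; taking then q = p / k, it
    shows that A is a multiple of D. *)
Lemma gradients_parallel A B D t : 0 < t < 1 -> A != 0 -> B != 0 ->
  (forall p q, dot D (t *: p + (1 - t) *: q) < dot A p ->
     dot B q <= dot D (t *: p + (1 - t) *: q)) ->
  exists sigma tau, [/\ 0 < sigma, 0 < tau, A = sigma *: D, B = tau *: D &
    t / sigma + (1 - t) / tau = 1].
Proof.
move=> /andP[t0 t1] A0 B0 AB.
have AA := dot_gt0 A0; have BB := dot_gt0 B0.
have t10 : 0 < 1 - t by lra.
have half p : 0 < dot A p -> 0 <= dot B p.
  move=> Ap; have := AB ((1 - t) *: p) (- t *: p).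
  have -> : t *: ((1 - t) *: p) + (1 - t) *: (- t *: p) = 0.
    by apply/rowP => i; rewrite !mxE; ring.
  rewrite dot0r !dotZr mulNr oppr_le0 pmulr_rge0// => h; apply: h.
  by rewrite mulr_gt0.
pose k := dot A B / dot A A.
have BkA : B = k *: A.
  apply/eqP; rewrite -subr_eq0; apply/eqP; set r := B - _.
  have Ar : dot A r = 0.
    by rewrite /r dotDr dotNr dotZr /k divfK ?subrr// gt_eqF.
  have Br : dot B r = dot r r.
    have {1}-> : B = r + k *: A by rewrite subrK.
    by rewrite dotDl dotZl Ar mulr0 addr0.
  apply: dot_eq0; apply/eqP; rewrite eq_le dot_ge0 andbT leNgt; apply/negP => rr.
  (* The component r of B orthogonal to A does not change A.(A - u r), and
     makes B.(A - u r) = -1. *)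
  pose u := (dot A B + 1) / dot r r.
  have := half (A - u *: r); rewrite !dotDr !dotNr !dotZr Ar mulr0 subr0.
  rewrite (dotC B) Br /u divfK ?gt_eqF// => /(_ AA); lra.
have k0 : 0 < k.
  have : 0 <= k by rewrite divr_ge0 ?dot_ge0// dotC half.
  rewrite le_eqVlt => /predU1P[kE|//].
  by move: B0; rewrite BkA -kE scale0r eqxx.
pose s := t + (1 - t) / k.
have s0 : 0 < s by rewrite addr_gt0// divr_gt0.
have AsD : A = s *: D.
  apply/eqP; rewrite -subr_eq0; apply/eqP; set r := A - _.
  apply: dot_eq0; apply/eqP; rewrite eq_le dot_ge0 andbT leNgt; apply/negP => rr.
  have := AB r (k^-1 *: r).
  have -> : t *: r + (1 - t) *: (k^-1 *: r) = s *: r.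
    by rewrite scalerA -scalerDl.
  have -> : dot B (k^-1 *: r) = dot A r.
    by rewrite BkA dotZr dotZl mulrA mulVf ?gt_eqF// mul1r.
  rewrite dotZr.
  have e : dot A r - s * dot D r = dot r r.
    by rewrite -dotZl -dotNl -dotDl.
  have lt1 : s * dot D r < dot A r by lra.
  by move=> /(_ lt1); rewrite leNgt lt1.
exists s, (k * s); split => //; first by rewrite mulr_gt0.
  by rewrite BkA AsD scalerA.
have : s * k = t * k + (1 - t) by rewrite /s mulrDl divfK// gt_eqF.
move=> e; apply/eqP; rewrite invfM mulrA -mulrDl -/s.
by rewrite divff// gt_eqF.
Qed.

End Parallel.

(** * The potential outside a convex body *)

Section Potential.
Context {R : realType} {n : nat}.
Variables (C : set 'rV[R]_n) (v : 'rV[R]_n -> R) (x0 : 'rV[R]_n) (r0 : R).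
Hypotheses (n0 : (0 < n)%N) (bodyC : convex_body C) (r00 : 0 < r0)
  (ballC : forall y, `|y - x0| < r0 -> C y) (capv : capacitary C v).
Implicit Types (f : 'rV[R]_n -> R) (x y z p q N e : 'rV[R]_n) (s t : R).

Let Cclosed : closed C.
Proof. by apply: compact_closed; [exact: norm_hausdorff | case: bodyC]. Qed.

Let Cx0 : C x0.
Proof. by apply: ballC; rewrite subrr normr0. Qed.

Lemma nbhs_exterior x : ~ C x -> nbhs x (~` C).
Proof. by move=> Cx; apply: open_nbhs_nbhs; split => //; exact: closed_openC Cclosed. Qed.

(** The maximum principle in an unbounded domain: the condition at infinity
    provides the boundary values on a large sphere. *)
Lemma exterior_maximum f c : continuous f ->
  (forall x, C x -> ~ nbhs x C -> f x <= c) ->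
  (forall x, ~ C x -> exists2 L, has_laplacian f x L & 0 <= L) ->
  (forall e : R, 0 < e -> exists M, forall x, M < `|x| -> f x <= c + e) ->
  forall x, ~ nbhs x C -> f x <= c.
Proof.
move=> cf fC lapf finf x xC; apply/ler_addgt0Pr => e e0.
have [M fM] := finf e e0.
pose r := Num.max M `|x| + 1.
pose K := [set y : 'rV[R]_n | `|y| <= r] `&` ~` C^°.
have cK : compact K.
  apply: (@subclosed_compact _ K _ _ (@compact_ball_norm R n r)); last first.
    by move=> y [].
  apply: closedI; last by apply: open_closedC; exact: open_interior.
  by apply: closed_le_continuous; exact: norm_continuous.
have rx : `|x| < r by rewrite /r ltr_pwDr// le_max lexx orbT.
have rM : M < r by rewrite /r ltr_pwDr// le_max lexx.
suff H y : K y -> f y <= c + e \/ (nbhs y K /\ exists2 L, has_laplacian f y L & 0 <= L).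
  by apply: (weak_maximum n0 cK cf H); split; [exact: ltW | ].
move=> [yr yC].
have [Cy|Cy] := pselect (C y).
  by left; rewrite (le_trans (fC y Cy yC))// lerDl ltW.
have [yM|yM] := ltP M `|y|; first by left; exact: fM.
right; split; last exact: lapf.
apply: filterI.
  exact: (ball_norm_interior (le_lt_trans yM rM)).
apply: filterS (nbhs_exterior Cy) => z Cz /nbhs_singleton; exact: Cz.
Qed.


Let cv : continuous v. Proof. by case: capv. Qed.
Let v1 x : C x -> v x = 1. Proof. by case: capv => _ + _ _; exact. Qed.
Let harm x : ~ C x -> harmonic_at v x.
Proof. by case: capv => _ _ + _; exact. Qed.
Let lapv x : ~ C x -> has_laplacian v x 0.
Proof. by move=> /harm; exact: harmonic_has_laplacian. Qed.
Let vinf (e : R) : 0 < e -> exists M : R, forall x, M < `|x| -> `|v x| < e.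
Proof.
case: capv => _ _ _ vl e0; have [M vM] := vl e e0.
by exists M => x /vM; rewrite subr0.
Qed.

Let nbhsC x : nbhs x C -> C x. Proof. exact: nbhs_singleton. Qed.

Lemma potential_le1 x : v x <= 1.
Proof.
have [/nbhsC Cx|Cx] := pselect (nbhs x C); first by rewrite v1.
apply: exterior_maximum Cx => // [y Cy _|y Cy|e e0]; first by rewrite v1.
  by exists 0; [exact: lapv|].
have [M vM] := vinf e0; exists M => y /vM.
by rewrite ltr_norml => /andP[_]; lra.
Qed.

Lemma potential_ge0 x : 0 <= v x.
Proof.
have [/nbhsC Cx|Cx] := pselect (nbhs x C); first by rewrite v1.
pose f y := -1 * v y + 0 * v y.
suff : f x <= 0 by rewrite /f; lra.
apply: exterior_maximum Cx => [|y Cy _|y Cy|e e0].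
- exact: comb_continuous.
- by rewrite /f v1//; lra.
- by exists (-1 * 0 + 0 * 0); [apply: has_laplacian_comb; exact: lapv|lra].
- have [M vM] := vinf e0; exists M => y /vM.
  by rewrite ltr_norml /f => /andP[+ _]; lra.
Qed.

(** The barrier is the affine function itself. On the part of the half-space
    in a large ball, v + c (N.x - beta) is harmonic; it is at most 1 where N.x
    = beta because v <= 1, and on the far part because v <= 1/2 there while c
    is chosen so small that the affine term is at most 1/2. *)
Lemma half_space_bound (rho : R) : exists2 c : R, 0 < c &
  forall N (beta : R), `|N| <= 1 -> (forall y, C y -> dot N y <= beta) ->
  forall x, `|x| <= rho -> beta <= dot N x -> v x <= 1 - c * (dot N x - beta).
Proof.
have [M vM] := vinf (divr_gt0 ltr01 (ltr0Sn R 1)).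
pose r := Num.max 0 (Num.max M rho) + 1.
have r1 : 0 < r by rewrite /r ltr_wpDl// le_max lexx.
have rM : M < r by rewrite /r ltr_pwDr// !le_max lexx orbT.
have rrho : rho <= r by rewrite /r ler_wpDr// !le_max lexx !orbT.
pose D := n%:R * (r + `|x0|).
have n1 : 0 < n%:R :> R by rewrite ltr0n.
have D0 : 0 < D by rewrite mulr_gt0// ltr_pwDl.
exists (1 / 2 / D); first by rewrite !divr_gt0.
move=> N beta N1 NC x xrho xb.
have lD y : `|y| <= r -> dot N y - beta <= D.
  move=> yr; have : dot N y <= n%:R * r.
    rewrite (le_trans (ler_norm _))// (le_trans (norm_dot_le _ _))//.
    by rewrite -mulrA ler_pM2l// -[leRHS]mul1r ler_pM.
  have : - beta <= n%:R * `|x0|.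
    apply: (@le_trans _ _ (- dot N x0)); first by rewrite lerN2 NC.
    rewrite (le_trans (ler_norm _))// normrN (le_trans (norm_dot_le _ _))//.
    by rewrite -mulrA ler_pM2l// -[leRHS]mul1r ler_pM.
  by move=> b1 b2; rewrite /D mulrDr lerD.
set c := 1 / 2 / D; have c0 : 0 < c by rewrite !divr_gt0.
have cD : c * D = 1 / 2 by rewrite /c divfK// gt_eqF.
pose f y := 1 * v y + c * (dot N y - beta).
suff : f x <= 1 by rewrite /f mul1r; lra.
have cl : continuous (fun y => dot N y - beta).
  move=> y; have h := @dot_continuous R n N y.
  by apply: (cvgB h); exact: cvg_cst.
have cf : continuous f.
  exact: comb_continuous.
pose K := [set y : 'rV[R]_n | `|y| <= r] `&` [set y | - (dot N y - beta) <= 0].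
have cK : compact K.
  apply: (@subclosed_compact _ K _ _ (@compact_ball_norm R n r)); last first.
    by move=> y [].
  apply: closedI; apply: closed_le_continuous; first exact: norm_continuous.
  by move=> y; exact: (cvgN (@cl y)).
suff H y : K y -> f y <= 1 \/ (nbhs y K /\ exists2 L, has_laplacian f y L & 0 <= L).
  apply: (weak_maximum n0 cK cf H).
  by split; [exact: le_trans rrho | rewrite /= oppr_le0 subr_ge0].
move=> [/= yr]; rewrite oppr_le0 => yb.
have [l0|l0] := leP (dot N y - beta) 0.
  left; have -> : f y = v y; last exact: potential_le1.
  have -> : f y = v y + c * (dot N y - beta) by rewrite /f mul1r.
  have -> : dot N y - beta = 0 by apply/eqP; rewrite eq_le l0 yb.
  by rewrite mulr0 addr0.
have [yM|yM] := ltP M `|y|.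
  left; have := vM _ yM; rewrite ltr_norml => /andP[_ vy].
  have : c * (dot N y - beta) <= c * D by rewrite ler_pM2l// lD.
  by rewrite /f; lra.
have Cy : ~ C y by move=> /NC; rewrite leNgt -subr_gt0 l0.
right; split.
  apply: filterI.
    exact: (ball_norm_interior (le_lt_trans yM rM)).
  apply: filterS (nbhs_gt_continuous cl l0) => z /= /ltW.
  by rewrite oppr_le0.
exists (1 * 0 + c * 0); last by lra.
by apply: has_laplacian_comb; [exact: lapv | exact: (has_laplacian_dotD _ N (- beta))].
Qed.

Lemma potential_lt1 x : ~ C x -> v x < 1.
Proof.
move=> Cx; have [N [beta [N1 NC [p Cp xp]]]] := separation bodyC (ex_intro _ _ Cx0) Cx.
have [c c0 half] := half_space_bound `|x|.
have l0 : 0 < dot N x - beta.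
  apply: lt_le_trans xp; rewrite normr_gt0 subr_eq0; apply/eqP => e.
  by apply: Cx; rewrite e.
apply: le_lt_trans (half _ _ N1 NC x (lexx _) _) _; first by rewrite -subr_ge0 ltW.
by rewrite ltrBlDr ltrDl mulr_gt0.
Qed.

(** Were some p in C nearer than (s - 1) r0 to the image of x, then x would be
    a convex combination of p and of a point of the ball about x0, hence
    interior to C. *)
Lemma dilation_outside s x p : 1 < s -> ~ nbhs x C -> C p ->
  (s - 1) * r0 <= `|s *: x + (1 - s) *: x0 - p|.
Proof.
move=> s1 xC Cp; rewrite leNgt; apply/negP => close; apply: xC.
set phi := s *: x + (1 - s) *: x0 in close *.
have s0 : 0 < s by lra.
have s10 : 0 < s - 1 by lra.
pose k := (s - 1) * r0 - `|phi - p|.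
have k0 : 0 < k by rewrite subr_gt0.
apply/nbhs_delta; exists (k / s); first by rewrite divr_gt0.
move=> y; rewrite ltr_pdivlMr// => xy.
(* The point with y = p / s + (1 - 1 / s) w. *)
pose w := x0 + (s - 1)^-1 *: (phi - p + s *: (y - x)).
have Cw : C w.
  apply: ballC; rewrite /w addrAC subrr add0r normrZ normfV (gtr0_norm s10).
  rewrite mulrC ltr_pdivrMr// mulrC.
  apply: le_lt_trans (ler_normD _ _) _.
  by rewrite normrZ (gtr0_norm s0); move: xy; rewrite /k mulrC; lra.
have -> : y = s^-1 *: p + (1 - s^-1) *: w.
  apply/rowP => i; rewrite /w /phi !mxE; field.
  by rewrite !gt_eqF.
apply: bodyC.2 => //.
by rewrite invr_ge0 ltW//= invf_le1// ltW.
Qed.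

(** Both sides are harmonic in x off C, so the inequality need only be checked
    on the boundary of C. There v = 1 and the dilated point is at distance at
    least (s - 1) r0 from C, so that [half_space_bound] for the separating
    half-space applies. *)
Lemma radial_decay : exists2 c : R, 0 < c &
  forall s x, 1 < s -> s <= 2 -> ~ C x ->
  v (s *: x + (1 - s) *: x0) <= (1 - c * (s - 1)) * v x.
Proof.
have [B CB] : exists B : R, forall x, C x -> `|x| <= B.
  have [c _ cmax] := compact_max bodyC.1 (ex_intro _ _ Cx0)
    (f := fun y : 'rV[R]_n => `|y|) (@norm_continuous _ _).
  by exists `|c|.
have [c0 c00 half] := half_space_bound (2 * B + `|x0|).
pose c := Num.min 1 (c0 * r0).
have cpos : 0 < c by rewrite lt_min ltr01 mulr_gt0.
exists c => // s x s1 s2 Cx.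
have s0 : s != 0 by rewrite gt_eqF//; lra.
have cs0 : 0 <= c * (s - 1) by rewrite mulr_ge0//; [exact: ltW | lra].
have cs1 : c * (s - 1) <= 1.
  have c1 : c <= 1 by rewrite ge_min lexx.
  by rewrite -[leRHS]mul1r ler_pM//; [exact: ltW | lra | lra].
pose f y := 1 * v (s *: y + (1 - s) *: x0) + (c * (s - 1) - 1) * v y.
suff : f x <= 0 by rewrite /f; lra.
have caff : continuous (fun y => v (s *: y + (1 - s) *: x0)).
  move=> y; apply: (@continuous_comp _ _ _ (fun y => s *: y + (1 - s) *: x0) v).
    exact: affine_continuous.
  exact: cv.
apply: (exterior_maximum (f := f)) => [|y Cy yC|y Cy|e e0|].
- exact: comb_continuous.
- rewrite /f (v1 Cy).
  set phi := s *: y + (1 - s) *: x0.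
  have far p : C p -> (s - 1) * r0 <= `|phi - p| by exact: dilation_outside.
  have sr : 0 < (s - 1) * r0 by rewrite mulr_gt0//; lra.
  have Cphi : ~ C phi by move=> /far; rewrite subrr normr0 leNgt sr.
  have [N [beta [N1 NC [p Cp phip]]]] := separation bodyC (ex_intro _ _ Cx0) Cphi.
  have l0 : (s - 1) * r0 <= dot N phi - beta by apply: le_trans phip; exact: far.
  have : v phi <= 1 - c0 * (dot N phi - beta).
    apply: half => //; last by rewrite -subr_ge0; apply: le_trans l0; exact: ltW.
    apply: le_trans (ler_normD _ _) _; rewrite !normrZ lerD//.
      by rewrite gtr0_norm; [apply: ler_pM => //; [lra|exact: CB] | lra].
    by rewrite -[leRHS]mul1r ler_wpM2r// ler0_norm; lra.
  have : c0 * ((s - 1) * r0) <= c0 * (dot N phi - beta) by rewrite ler_pM2l.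
  have : c * (s - 1) <= c0 * r0 * (s - 1).
    by rewrite ler_wpM2r//; [lra | rewrite ge_min lexx orbT].
  by lra.
- exists (1 * 0 + (c * (s - 1) - 1) * 0); last by lra.
  apply: has_laplacian_comb; last exact: lapv.
  apply: has_laplacian_affine => //; apply: lapv => Cphi; apply: Cy.
  have -> : y = s^-1 *: (s *: y + (1 - s) *: x0) + (1 - s^-1) *: x0.
    by apply/rowP => i; rewrite !mxE; field.
  apply: bodyC.2 => //; rewrite invr_ge0 invf_le1; first by apply/andP; split; lra.
  by lra.
- have [M vM] := vinf e0; exists (M + `|x0|) => y My.
  have : v (s *: y + (1 - s) *: x0) < e.
    apply: le_lt_trans (ler_norm _) _; apply: vM.
    have := ler_normB (s *: y + (1 - s) *: x0) ((1 - s) *: x0).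
    rewrite addrK !normrZ (@ltr0_norm _ (1 - s)); last by lra.
    rewrite (@gtr0_norm _ s); last by lra.
    have : (s - 2) * `|x0| <= 0 by rewrite mulr_le0_ge0// subr_le0.
    have : 0 <= (s - 1) * `|y| by rewrite mulr_ge0// subr_ge0 ltW.
    by lra.
  have : 0 <= (1 - c * (s - 1)) * v y by rewrite mulr_ge0 ?potential_ge0// subr_ge0.
  by rewrite /f; lra.
- by move/nbhsC.
Qed.

(** The first-order part of [radial_decay] as s tends to 1. *)
Lemma radial_gradient x a : ~ C x -> 0 < v x -> strict_gradient v x a ->
  0 < dot a (x0 - x).
Proof.
move=> Cx vx sa.
have [c c0 decay] := radial_decay.
suff : dot a (x - x0) <= - (c * v x).
  have : 0 < c * v x by rewrite mulr_gt0.
  by rewrite -[x0 - x]opprB dotNr; lra.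
rewrite leNgt; apply/negP => lt1.
have lim := lim0D (first_order_gradient (x - x0) sa) (lim0_cst (c * v x)).
have [|h [h0 h1]] := lim0_gt0_below _ ltr01 lim; first by lra.
have -> : x + h *: (x - x0) = (1 + h) *: x + (1 - (1 + h)) *: x0.
  by apply/rowP => i; rewrite !mxE; ring.
have s1 : 1 < 1 + h by rewrite ltrDl.
have s2 : 1 + h <= 2 by lra.
have le1 := decay (1 + h) x s1 s2 Cx.
apply/negP; rewrite -leNgt -lerBrDr sub0r ler_pdivrMr// lerBlDr.
apply: le_trans le1 _; by rewrite le_eqVlt; apply/orP; left; apply/eqP; ring.
Qed.

(** * Convexity of the superlevel sets *)

Let w x := cubic (v x).

Let cw : continuous w.
Proof.
move=> x; have c : v @ x --> v x := @cv x.
exact: (cvgD c (cvgMl (cvgM c (cvgM c c)))).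
Qed.

(** A positive value measures the failure of quasiconcavity of v on the
    segment from x to y. *)
Definition gabriel t x y := Num.min (w x) (w y) - w (t *: x + (1 - t) *: y).

Lemma first_order_cubic x a d : strict_gradient v x a ->
  lim0 (fun h => (w (x + h *: d) - w x) / h)
    (dot ((1 + v x ^+ 2 / 4) *: a) d).
Proof.
move=> sa; have fo := first_order_gradient d sa.
have := @lim0_cubic _ (fun h => v (x + h *: d)) (dot a d).
rewrite scale0r addr0 dotZl; exact.
Qed.

Lemma second_order_w x a b i j (r s : R) : r != 0 ->
  strict_gradient v x a -> taylor2 v x (delta_mx 0 i) (a 0 i) b ->
  lim0 (fun h => (w (x + (r * h) *: delta_mx 0 i + (s * h ^+ 2) *: delta_mx 0 j)
      - w x - h * (r * ((1 + v x ^+ 2 / 4) *: a) 0 i)) / h ^+ 2)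
    (r ^+ 2 * ((1 + v x ^+ 2 / 4) * b + v x / 2 * a 0 i ^+ 2) / 2
      + s * ((1 + v x ^+ 2 / 4) *: a) 0 j).
Proof.
move=> r0' sa ta; rewrite !mxE.
have := second_order_cubic (@second_order_parabola _ _ v x a b i j r s r0' sa ta).
rewrite /second_order expr0n/= !mulr0 !scale0r !addr0 => so.
have -> : r ^+ 2 * ((1 + v x ^+ 2 / 4) * b + v x / 2 * a 0 i ^+ 2) / 2
      + s * ((1 + v x ^+ 2 / 4) * a 0 j) =
   (1 + v x ^+ 2 / 4) * (r ^+ 2 * b / 2 + s * a 0 j) +
       v x / 4 * (r * a 0 i) ^+ 2 by field.
by apply: lim0_eq so => h h0; rewrite /w /cubic; congr (_ / _); ring.
Qed.

(** Far from the origin w is smaller than the given positive value, so the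
    maximum may be sought in a product of two balls. *)
Lemma gabriel_max t x1 y1 : 0 < gabriel t x1 y1 -> exists x y,
  0 < gabriel t x y /\ forall p q, gabriel t p q <= gabriel t x y.
Proof.
move=> pos; set m := gabriel t x1 y1 in pos.
have w_ge0 x : 0 <= w x.
  by rewrite addr_ge0 ?divr_ge0 ?exprn_ge0 ?potential_ge0.
have [M wM] : exists M, forall x, M < `|x| -> w x < m.
  have [M vM] := vinf (divr_gt0 pos (ltr0Sn R 1)); exists M => x /vM.
  move=> /(le_lt_trans (ler_norm _)) vm.
  have : v x ^+ 3 <= v x.
    by rewrite exprS ler_piMr ?exprn_ile1 ?potential_ge0 ?potential_le1.
  by have := potential_ge0 x; rewrite /w /cubic; lra.
pose r := Num.max M (Num.max `|x1| `|y1|).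
pose B := [set y : 'rV[R]_n | `|y| <= r].
have BB1 : (B `*` B) (x1, y1) by split; rewrite /B/= !le_max lexx !orbT.
have cF : continuous (fun z : 'rV[R]_n * 'rV[R]_n => gabriel t z.1 z.2).
  have cfst : continuous (fst : 'rV[R]_n * 'rV[R]_n -> 'rV[R]_n).
    by move=> z; exact: cvg_fst.
  have csnd : continuous (snd : 'rV[R]_n * 'rV[R]_n -> 'rV[R]_n).
    by move=> z; exact: cvg_snd.
  have cmid : continuous (fun z : 'rV[R]_n * 'rV[R]_n =>
      t *: z.1 + (1 - t) *: z.2).
    by move=> z; exact: (cvgD (cvgZl_tmp (cfst z)) (cvgZl_tmp (csnd z))).
  have ccomp (g : 'rV[R]_n * 'rV[R]_n -> 'rV[R]_n) :
      continuous g -> continuous (w \o g).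
    by move=> cg z; apply: continuous_comp; [exact: cg | exact: cw].
  move=> z; have cm := continuous_min (ccomp _ cfst z) (ccomp _ csnd z).
  exact: (cvgB cm (ccomp _ cmid z)).
have cB : compact B := @compact_ball_norm R n r.
have [|[x y] /set_mem[Bx By] xymax] := @compact_EVT_max _ R
    (fun z : 'rV[R]_n * 'rV[R]_n => gabriel t z.1 z.2) (B `*` B)
    (ex_intro _ _ BB1) (compact_setX cB cB).
  exact: continuous_subspaceT cF.
have mxy : m <= gabriel t x y by have := xymax (x1, y1) (mem_set BB1).
exists x, y; split; first exact: lt_le_trans mxy.
move=> p q; rewrite leNgt; apply/negP => big.
have : m < gabriel t p q by exact: le_lt_trans big.
rewrite /gabriel ltrBrDr lt_min.
have := w_ge0 (t *: p + (1 - t) *: q) => wz /andP[mp mq].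
have Br z : m < w z -> `|z| <= r.
  move=> mz; rewrite le_max; apply/orP; left; rewrite leNgt; apply/negP => /wM.
  by rewrite ltNge ltW.
have : gabriel t p q <= gabriel t x y.
  by apply: (xymax (p, q)); apply/mem_set; split; apply: Br; lra.
by rewrite leNgt big.
Qed.

Lemma no_local_max y : ~ C y -> 0 < v y -> ~ nbhs y [set q | v q <= v y].
Proof.
move=> Cy vy loc.
have [a [_ [sa _ _]]] := harm Cy.
have [del del0 le1] := nbhs_line (x0 - y) loc.
have [h [h0 hd]] := lim0_gt0_below (radial_gradient Cy vy sa) del0
  (first_order_gradient (x0 - y) sa).
have := le1 h; rewrite gtr0_norm// => /(_ hd) /= le2.
by rewrite pmulr_lgt0 ?invr_gt0// subr_gt0 ltNge le2.
Qed.

(** If v y < v x then near the maximum the minimum is w at the second point.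
    Moving that point arbitrarily and the first one so as to keep z fixed
    shows that y is a local maximum of v. *)
Lemma gabriel_max_le t x y : 0 < t < 1 -> 0 < gabriel t x y ->
  (forall p q, gabriel t p q <= gabriel t x y) -> v x <= v y.
Proof.
move=> /andP[t0 t1] pos xymax; rewrite leNgt; apply/negP => yx.
have wyx : w y < w x by rewrite cubic_lt.
have Cy : ~ C y.
  move=> /v1 vy; have := potential_le1 x.
  by rewrite leNgt -vy yx.
have vy : 0 < v y.
  rewrite -cubic_lt; apply: (@le_lt_trans _ _ (w (t *: x + (1 - t) *: y))).
    by rewrite cubic_le potential_ge0.
  by move: pos; rewrite /gabriel subr_gt0 lt_min => /andP[].
apply: (no_local_max Cy vy).
(* The position of the first point which keeps t p + (1 - t) q constant. *)
pose P q := - ((1 - t) / t) *: q + (x + ((1 - t) / t) *: y).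
have Py : P y = x by apply/rowP => i; rewrite !mxE; ring.
have cP : continuous (fun q => w (P q) - w q).
  have cwP : continuous (w \o P).
    move=> q; apply: continuous_comp; last exact: cw.
    exact: affine_continuous.
  move=> q; have c1 : w (P q') @[q' --> q] --> w (P q) := @cwP q.
  exact: (cvgB c1 (@cw q)).
have : nbhs y [set q | 0 < w (P q) - w q].
  by apply: nbhs_gt_continuous cP _; rewrite Py subr_gt0.
apply: filterS => q /=; rewrite subr_gt0 => wq.
have := xymax (P q) q; rewrite /gabriel.
have -> : t *: P q + (1 - t) *: q = t *: x + (1 - t) *: y.
  by apply/rowP => i; rewrite !mxE; field; rewrite gt_eqF.
rewrite lerD2r (min_r (ltW wq)) (min_r (ltW wyx)).
by rewrite cubic_le.
Qed.

Lemma gabrielC t x y : gabriel t x y = gabriel (1 - t) y x.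
Proof.
rewrite /gabriel minC; congr (_ - w _).
by apply/rowP => i; rewrite !mxE; ring.
Qed.

Lemma gabriel_max_improve t x y p q : v x = v y ->
  (forall p q, gabriel t p q <= gabriel t x y) ->
  0 < (w p - w x) - (w (t *: p + (1 - t) *: q) - w (t *: x + (1 - t) *: y)) ->
  0 < (w q - w y) - (w (t *: p + (1 - t) *: q) - w (t *: x + (1 - t) *: y)) ->
  False.
Proof.
move=> vxy xymax h1 h2; have := xymax p q; apply/negP; rewrite -ltNge.
have e : w y = w x by rewrite /w -vxy.
rewrite /gabriel e minxx ltrBrDr lt_min; rewrite e in h2.
by apply/andP; split; lra.
Qed.

Lemma gabriel_max_first t x y a b c : v x = v y ->
  (forall p q, gabriel t p q <= gabriel t x y) ->
  strict_gradient v x a -> strict_gradient v y b ->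
  strict_gradient v (t *: x + (1 - t) *: y) c ->
  let D := (1 + v (t *: x + (1 - t) *: y) ^+ 2 / 4) *: c in
  forall p q, dot D (t *: p + (1 - t) *: q) < dot ((1 + v x ^+ 2 / 4) *: a) p ->
    dot ((1 + v y ^+ 2 / 4) *: b) q <= dot D (t *: p + (1 - t) *: q).
Proof.
move=> vxy xymax sa sb sc D p q lt1; rewrite leNgt; apply/negP => lt2.
set r := t *: p + (1 - t) *: q in lt1 lt2; set z := _ + _ in sc D lt1 lt2.
have lz := lim0Z (-1) (first_order_cubic r sc).
have [||h [h0]] := lim0_gt0_pair _ _ (lim0D (first_order_cubic p sa) lz)
   (lim0D (first_order_cubic q sb) lz).
- by rewrite mulN1r subr_gt0.
- by rewrite mulN1r subr_gt0.
rewrite !mulN1r -!mulNr -!mulrDl !pmulr_lgt0 ?invr_gt0//.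
have e : t *: (x + h *: p) + (1 - t) *: (y + h *: q) = z + h *: r.
  by apply/rowP => i; rewrite !mxE; ring.
by rewrite -e; exact: gabriel_max_improve.
Qed.

(** Displace x, y, z by h / sigma, h / tau, h along the i-th axis; the
    first-order changes of w agree. A further displacement of x by order h^2
    along an axis j on which the gradient does not vanish makes the
    second-order changes of w x and w y equal, and z inherits t times it. If
    the inequality failed, both differences would increase. *)
Lemma gabriel_max_second t x y a b c hx hy hz i sigma tau : v x = v y ->
  (forall p q, gabriel t p q <= gabriel t x y) ->
  let z := t *: x + (1 - t) *: y in
  let G := 1 + v x ^+ 2 / 4 in let H := 1 + v z ^+ 2 / 4 in
  strict_gradient v x a -> taylor2 v x (delta_mx 0 i) (a 0 i) hx ->
  strict_gradient v y b -> taylor2 v y (delta_mx 0 i) (b 0 i) hy ->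
  strict_gradient v z c -> taylor2 v z (delta_mx 0 i) (c 0 i) hz ->
  G *: a = sigma *: (H *: c) -> G *: b = tau *: (H *: c) ->
  0 < sigma -> 0 < tau -> t / sigma + (1 - t) / tau = 1 -> H *: c != 0 ->
  t / sigma * ((G * hx + v x / 2 * a 0 i ^+ 2) / sigma ^+ 2)
  + (1 - t) / tau * ((G * hy + v x / 2 * b 0 i ^+ 2) / tau ^+ 2)
  <= H * hz + v z / 2 * c 0 i ^+ 2.
Proof.
move=> vxy xymax z G H sa ta sb tb sc tc aE bE sig0 tau0 st D0.
set D := H *: c in aE bE D0.
have [j Dj] := norm_attained D0.
have {}Dj : D 0 j != 0 by rewrite -normr_gt0 -Dj normr_gt0.
set X := G * hx + _; set Y := G * hy + _; set Z := H * hz + _.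
rewrite leNgt; apply/negP => Kpos.
(* The coefficient of h^2 along the axis j which equalizes the second-order
   changes at x and y. *)
pose s := (Y / tau ^+ 2 - X / sigma ^+ 2) / (2 * sigma * D 0 j).
have lx := @second_order_w x a hx i j _ s (invr_neq0 (lt0r_neq0 sig0)) sa ta.
have ly := @second_order_w y b hy i j _ 0 (invr_neq0 (lt0r_neq0 tau0)) sb tb.
have lz := lim0Z (-1) (@second_order_w z c hz i j _ (t * s) (oner_neq0 _) sc tc).
have xi k : G * a 0 k = sigma * D 0 k.
  by have /rowP/(_ k) := aE; rewrite [LHS]mxE [RHS]mxE.
have yi k : G * b 0 k = tau * D 0 k.
  by have /rowP/(_ k) := bE; rewrite [LHS]mxE [RHS]mxE.
rewrite -/G -/X !mxE !xi in lx.
rewrite -vxy -/G -/Y !mxE !yi in ly.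
rewrite -/H -/D -/Z in lz.
have st' : (1 - t) / tau = 1 - t / sigma by have := st; lra.
have sD : s * D 0 j = (Y / tau ^+ 2 - X / sigma ^+ 2) / (2 * sigma).
  by rewrite /s; field; rewrite Dj !gt_eqF.
rewrite st' in Kpos.
have [||h [h0]] := lim0_gt0_pair _ _ (lim0D lx lz) (lim0D ly lz).
- rewrite [s * (sigma * _)]mulrCA -[t * s * _]mulrA sD.
  rewrite [ltRHS](_ : _ = (t / sigma * (X / sigma ^+ 2) +
    (1 - t / sigma) * (Y / tau ^+ 2) - Z) / 2); last by field; rewrite !gt_eqF.
  by rewrite divr_gt0// subr_gt0.
- rewrite -[t * s * _]mulrA sD.
  rewrite [ltRHS](_ : _ = (t / sigma * (X / sigma ^+ 2) +
    (1 - t / sigma) * (Y / tau ^+ 2) - Z) / 2); last by field; rewrite !gt_eqF.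
  by rewrite divr_gt0// subr_gt0.
have h2 : 0 < h ^+ 2 by rewrite exprn_gt0.
rewrite !mulN1r -!mulNr -!mulrDl !pmulr_lgt0 ?invr_gt0//.
set p := x + _ + _; set q := y + _ + _; set r := z + _ + _.
have e : t *: p + (1 - t) *: q = r.
  have -> : t *: p + (1 - t) *: q = z + ((t / sigma + (1 - t) / tau) * h) *:
      delta_mx 0 i + (t * s * h ^+ 2) *: delta_mx 0 j.
    by apply/rowP => k; rewrite !mxE; ring.
  by rewrite st.
rewrite -e => h3 h4.
apply: (@gabriel_max_improve t x y p q) => //; rewrite -/z.
  move: h3; rewrite mulKf ?gt_eqF// mul1r; lra.
move: h4; rewrite mulKf ?gt_eqF// mul1r; lra.
Qed.

(** At a positive maximum v x = v y by [gabriel_max_le], and x, y, z lie off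
    C. Summing [gabriel_max_second] over the axes contradicts
    [cubic_ratio_lt]. *)
Lemma gabriel_le0 t x1 y1 : 0 < t < 1 -> gabriel t x1 y1 <= 0.
Proof.
move=> t01; rewrite leNgt; apply/negP => /gabriel_max[x [y [pos xymax]]].
have /andP[t0 t1] := t01.
set z := t *: x + (1 - t) *: y.
have vxy : v x = v y.
  apply/eqP; rewrite eq_le (gabriel_max_le t01 pos xymax)/=.
  apply: (@gabriel_max_le (1 - t) y x); first by apply/andP; split; lra.
    by rewrite -gabrielC.
  by move=> p q; rewrite -!gabrielC.
have zx : v z < v x.
  by move: pos; rewrite /gabriel -/z subr_gt0 lt_min cubic_lt => /andP[].
have Cz : ~ C z by move=> /v1 e; have := potential_le1 x; rewrite leNgt -e zx.
have Cxy : (C x -> C y) /\ (C y -> C x).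
  split=> /v1 e; apply: contrapT => /potential_lt1; last by rewrite vxy e ltxx.
  by rewrite -vxy e ltxx.
have Cx : ~ C x.
  by move=> Cx; apply: Cz; apply: bodyC.2 => //; [exact: Cxy.1 | rewrite !ltW].
have Cy : ~ C y by move=> /Cxy.2.
have [a [hx [sa ta shx]]] := harm Cx.
have [b [hy [sb tb shy]]] := harm Cy.
have [c [hz [sc tc shz]]] := harm Cz.
set m := v x in vxy zx.
have m0 : 0 < m by apply: le_lt_trans zx; exact: potential_ge0.
pose G := 1 + m ^+ 2 / 4; pose H := 1 + v z ^+ 2 / 4.
have G0 : 0 < G by rewrite ltr_wpDr// divr_ge0// sqr_ge0.
have H0 : 0 < H by rewrite ltr_wpDr// divr_ge0// sqr_ge0.
have nz x' a' : ~ C x' -> 0 < v x' -> strict_gradient v x' a' -> a' != 0.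
  move=> h1 h2 h3; have := radial_gradient h1 h2 h3; apply: contraTneq => ->.
  by rewrite dot0l ltxx.
pose D := H *: c.
have [||p q lt1|sigma [tau [sig0 tau0 aE bE st]]] :=
    gradients_parallel (A := G *: a) (B := G *: b) (D := D) t01.
- by rewrite scaler_eq0 negb_or gt_eqF//; apply: nz sa.
- by rewrite scaler_eq0 negb_or gt_eqF//; apply: nz sb; rewrite -?vxy.
- have bE : G *: b = (1 + v y ^+ 2 / 4) *: b by rewrite /G vxy.
  by rewrite bE; apply: (gabriel_max_first vxy xymax sa sb sc).
have DD : 0 < dot D D.
  apply: dot_gt0; apply/eqP => D0; move: aE; rewrite D0 scaler0.
  by move=> /eqP; rewrite scaler_eq0 gt_eqF//= (negPf (nz _ _ Cx m0 sa)).
pose X i := G * hx i + m / 2 * a 0 i ^+ 2.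
pose Y i := G * hy i + m / 2 * b 0 i ^+ 2.
pose Z i := H * hz i + v z / 2 * c 0 i ^+ 2.
pose K i := t / sigma * (X i / sigma ^+ 2) + (1 - t) / tau * (Y i / tau ^+ 2) - Z i.
have Kle i : K i <= 0.
  rewrite subr_le0; apply: (gabriel_max_second vxy xymax
    sa (ta i) sb (tb i) sc (tc i) aE _ sig0 tau0 st _).
  - exact: bE.
  - change (D != 0); by apply: contraTneq DD => ->; rewrite dot0l ltxx.
have sumsq (g q : R) (e : 'rV[R]_n) (bb : 'I_n -> R) (r : R) : 0 < g -> 0 < r ->
    g *: e = r *: D -> \sum_i bb i = 0 ->
    \sum_i (g * bb i + q / 2 * e 0 i ^+ 2) = r ^+ 2 * (q / 2 / g ^+ 2 * dot D D).
  move=> g0 r0' eD sb0; rewrite big_split/= -!mulr_sumr sb0 mulr0 add0r.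
  have -> : \sum_i e 0 i ^+ 2 = dot e e by apply: eq_bigr => i _; rewrite expr2.
  have : g ^+ 2 * dot e e = r ^+ 2 * dot D D.
    have sq k (u : 'rV[R]_n) : k ^+ 2 * dot u u = dot (k *: u) (k *: u).
      by rewrite dotZl dotZr mulrA.
    by rewrite !sq eD.
  move=> ee; have -> : dot e e = r ^+ 2 * dot D D / g ^+ 2.
    by rewrite -ee mulrAC divff ?mul1r// expf_neq0// gt_eqF.
  by field; rewrite gt_eqF.
have : \sum_i K i <= 0 by apply: sumr_le0 => i _.
rewrite sumrB big_split/= -!mulr_sumr -!mulr_suml.
rewrite (sumsq G m a hx sigma)// (sumsq G m b hy tau)//.
rewrite (sumsq H (v z) c hz 1)//; last by rewrite scale1r.
set M := m / 2 / G ^+ 2 * dot D D; set N := v z / 2 / H ^+ 2 * dot D D.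
have NM : N < M.
  by rewrite /M /N ltr_pM2r// cubic_ratio_lt//;
    [exact: potential_ge0 | exact: potential_le1].
have -> : t / sigma * (sigma ^+ 2 * M / sigma ^+ 2) +
    (1 - t) / tau * (tau ^+ 2 * M / tau ^+ 2) = (t / sigma + (1 - t) / tau) * M.
  by field; rewrite !gt_eqF.
by rewrite st mul1r expr1n mul1r subr_le0 leNgt NM.
Qed.

Lemma potential_quasiconcave t x y : 0 < t < 1 ->
  Num.min (v x) (v y) <= v (t *: x + (1 - t) *: y).
Proof.
move=> /(gabriel_le0 x y); rewrite subr_le0 !ge_min.
by rewrite !cubic_le.
Qed.

(** * Strict convexity of the superlevel sets *)

(** The point y lies off C because v y < 1, so [harmonic_continuation] applies
    to v - t on a cube about y. *)
Lemma level_extension y e t : 0 < t < 1 -> v y = t ->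
  (forall s, 0 <= s <= 1 -> v (y - s *: e) = t) ->
  exists2 d : R, 0 < d & forall s, 0 <= s <= d -> v (y + s *: e) = t.
Proof.
move=> /andP[t0 t1] vy back.
have Cy : ~ C y by move=> /v1 e1; move: t1; rewrite -vy e1 ltxx.
have [r rpos rC] := (nbhs_delta _ _).1 (nbhs_exterior Cy).
pose rho := r / 2; have rho0 : 0 < rho by rewrite divr_gt0.
pose f x := v x - t.
have cf : continuous f by move=> x; exact: (cvgB (@cv x) (cvg_cst t)).
have lw x : `|x - y| <= rho -> has_laplacian f x 0.
  move=> xy; have Cx : ~ C x by apply: rC; rewrite /rho in xy; lra.
  have [a [b [_ tb sb]]] := harm Cx.
  exists (fun i => a 0 i), b; split=> // i.
  by apply: lim0_eq (tb i) => h h0; rewrite /f; congr (_ / _); ring.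
have w1 x : `|x - y| <= rho -> `|f x| <= 1.
  move=> _; rewrite /f ler_norml; have := potential_ge0 x; have := potential_le1 x.
  by move=> h1 h2; apply/andP; split; lra.
have nn : 1 <= n%:R ^+ 2 :> R by rewrite exprn_ege1// ler1n.
pose D := 32 * n%:R ^+ 2 * (`|e| + 1).
have e1 : 0 < `|e| + 1 by rewrite ltr_wpDl.
have D0 : 0 < D by rewrite mulr_gt0// mulr_gt0// (lt_le_trans ltr01).
exists (Num.min 1 (rho / D)); first by rewrite lt_min ltr01 divr_gt0.
move=> s /andP[]; rewrite le_eqVlt => /predU1P[<-|s0]; first by rewrite scale0r addr0.
rewrite le_min ler_pdivlMr// => /andP[s1 sD].
apply/eqP; rewrite -subr_eq0; apply/eqP.
apply: (harmonic_continuation n0 cf rho0 lw w1 s0).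
  apply: le_trans sD; have : 0 <= n%:R ^+ 2 * s by rewrite mulr_ge0 ?exprn_ge0// ltW.
  by rewrite /D; lra.
move=> s' /andP[s'0 s's]; rewrite /f back ?subrr//.
by rewrite s'0 (le_trans s's).
Qed.

(** By [level_extension] the largest interval of the ray on which v = t cannot
    end, while v tends to 0 along the ray. *)
Lemma level_segment_false x y t : 0 < t < 1 -> x != y ->
  (forall s, 0 <= s <= 1 -> v (x + s *: (y - x)) = t) -> False.
Proof.
move=> t01 xy seg; have /andP[t0 t1] := t01.
pose e := y - x.
have e0 : 0 < `|e| by rewrite normr_gt0 subr_eq0 eq_sym.
pose S := [set T : R | 1 <= T /\ forall s, 0 <= s <= T -> v (x + s *: e) = t].
have S1 : S 1 by split.
have [M vM] := vinf t0.
have Sub T : S T -> T <= (M + `|x|) / `|e|.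
  move=> [T1 vT]; rewrite ler_pdivlMr// leNgt; apply/negP => big.
  have : `|v (x + T *: e)| < t.
    apply: vM; have := ler_normB (x + T *: e) x.
    by rewrite addrC addKr normrZ (@ger0_norm _ T); lra.
  by rewrite vT ?ger0_norm ?ltxx ?lexx ?(ltW t0)//; rewrite andbT; lra.
have hS : has_sup S by split; [exists 1 | exists ((M + `|x|) / `|e|)].
pose s := sup S.
have s1 : 1 <= s by apply: sup_upper_bound.
(* Below the supremum s of S the equality holds; at s it holds by
   continuity. *)
have below r : 0 <= r -> r < s -> v (x + r *: e) = t.
  move=> rpos rs; have sr : 0 < s - r by rewrite subr_gt0.
  have [T [T1 vT]] := sup_adherent sr hS.
  by rewrite subKr => rT; apply: vT; rewrite rpos ltW.
have at_s : v (x + s *: e) = t.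
  apply/eqP; apply: contraT => ne.
  have cg : continuous (fun p => `|v p - t|).
    by move=> p; exact: (cvg_norm (cvgB (@cv p) (cvg_cst t))).
  have gpos : 0 < `|v (x + s *: e) - t| by rewrite normr_gt0 subr_eq0.
  have [d d0 pos] := nbhs_line (- e) (nbhs_gt_continuous cg gpos).
  pose h := Num.min d 1 / 2.
  have m0 : 0 < Num.min d 1 by rewrite lt_min d0 ltr01.
  have hm : h < Num.min d 1 by rewrite /h; lra.
  have h0 : 0 < h by rewrite divr_gt0.
  have /andP[hd h1] : (h < d) && (h < 1) by rewrite -lt_min.
  have := pos h; rewrite gtr0_norm// => /(_ hd) /=.
  have -> : x + s *: e + h *: - e = x + (s - h) *: e.
    by apply/rowP => i; rewrite !mxE; ring.
  by rewrite below ?subrr ?normr0 ?ltxx//; lra.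
have [|d d0 ext] := level_extension (e := e) t01 at_s.
  move=> r /andP[rpos r1]; have -> : x + s *: e - r *: e = x + (s - r) *: e.
    by apply/rowP => i; rewrite !mxE; ring.
  move: rpos; rewrite le_eqVlt => /predU1P[<-|rpos]; first by rewrite subr0.
  by apply: below; lra.
have : S (s + d).
  split; first by lra.
  move=> r /andP[rpos rd]; have [rs|sr] := ltP r s; first exact: below.
  have -> : x + r *: e = x + s *: e + (r - s) *: e.
    by apply/rowP => i; rewrite !mxE; ring.
  by apply: ext; apply/andP; split; lra.
move=> /(sup_upper_bound hS); rewrite -/s; lra.
Qed.

(** Moving z slightly while x is kept fixed moves p slightly; so
    [potential_quasiconcave] applies to all points near z. *)
Lemma interior_of_combination p x z t (k : R) :
  0 < k < 1 -> t < v p -> t <= v x ->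
  z = k *: p + (1 - k) *: x -> nbhs z [set q | t <= v q].
Proof.
move=> k01 tp tx zE; have /andP[k0 k1] := k01.
pose P q := k^-1 *: q + (p - k^-1 *: z).
have Pz : P z = p by rewrite /P addrC subrK.
have cP : continuous (v \o P).
  by move=> q; apply: continuous_comp; [exact: affine_continuous | exact: cv].
have : nbhs z [set q | t < (v \o P) q] by apply: nbhs_gt_continuous; rewrite //= Pz.
apply: filterS => q /= tq.
have -> : q = k *: P q + (1 - k) *: x.
  by apply/rowP => i; rewrite /P zE !mxE; field; rewrite gt_eqF.
by apply: le_trans (potential_quasiconcave _ _ k01); rewrite le_min ltW.
Qed.

(** If the combination z is not interior, [interior_of_combination] excludes
    points p of the chord with v p > t, on either side of z; so v = t along
    the chord. *)
Lemma superlevel_strict x y t (k : R) : 0 < t < 1 -> t <= v x -> t <= v y ->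
  x != y -> 0 < k < 1 -> nbhs (k *: x + (1 - k) *: y) [set q | t <= v q].
Proof.
move=> t01 tx ty xy k01; have /andP[k0 k1] := k01.
apply: contrapT => zK; set z := _ + _ in zK.
apply: (level_segment_false t01 xy) => s s01.
set p := x + _.
have tp : t <= v p.
  have /andP[s0 s1] := s01.
  move: s0; rewrite le_eqVlt => /predU1P[se|s0].
    by rewrite /p -se scale0r addr0.
  move: s1; rewrite le_eqVlt => /predU1P[se|s1].
    by rewrite /p se scale1r addrC subrK.
  have -> : p = s *: y + (1 - s) *: x by apply/rowP => i; rewrite !mxE; ring.
  by apply: le_trans (potential_quasiconcave _ _ _); rewrite ?le_min ?tx ?ty ?s0.
apply/eqP; rewrite eq_le tp andbT leNgt; apply/negP => tltp; apply: zK.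
have /andP[s0 s1] := s01.
have [lt1|lt1|eq1] := ltgtP s (1 - k).
- have d0 : 0 < 1 - s by lra.
  apply: (interior_of_combination (p := p) (x := y) (k := k / (1 - s))) => //.
    by rewrite divr_gt0//= ltr_pdivrMr//; lra.
  by apply/rowP => i; rewrite !mxE; field; rewrite gt_eqF.
- have spos : 0 < s by lra.
  apply: (interior_of_combination (p := p) (x := x) (k := (1 - k) / s)) => //.
    by rewrite divr_gt0/= ?ltr_pdivrMr//; lra.
  by apply/rowP => i; rewrite !mxE; field; rewrite gt_eqF.
- have -> : z = p by apply/rowP => i; rewrite !mxE eq1; ring.
  by apply: filterS (nbhs_gt_continuous cv tltp) => q /ltW.
Qed.

End Potential.

(** * The potential of a domain as a capacitary potential *)

Section Extension.
Context {R : realType} {n : nat}.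
Implicit Types (f g u : 'rV[R]_n -> R) (x y : 'rV[R]_n) (Omega : set 'rV[R]_n).

Lemma strict_gradient_near f g x a :
  (\forall y \near x, f y = g y) -> strict_gradient f x a -> strict_gradient g x a.
Proof.
move=> /nbhs_delta[d1 d10 fg] sf e /sf[d2 d20 fe].
exists (Num.min d1 d2); first by rewrite lt_min d10.
move=> p q; rewrite !lt_min => /andP[p1 p2] /andP[q1 q2].
by rewrite -(fg _ p1) -(fg _ q1); exact: fe.
Qed.

Lemma harmonic_near f g x :
  (\forall y \near x, f y = g y) -> harmonic_at f x -> harmonic_at g x.
Proof.
move=> fg [a [b [sf tf sb]]]; exists a, b; split=> //.
  exact: strict_gradient_near sf.
by move=> i; exact: taylor2_near (tf i).
Qed.

(** This is where smoothness enters: continuity of the first partial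
    derivatives gives the strict gradient, and their differentiability along
    the axes the expansions. *)
Lemma smooth_harmonic (U : set 'rV[R]_n) f x : nbhs x U -> smooth_on U f ->
  laplacian f x = 0 -> harmonic_at f x.
Proof.
move=> xU sf lf.
have df i : \forall y \near x, derivable f y (delta_mx 0 i).
  by apply: filterS xU => y /(sf [::])[_ /(_ i)].
exists (\row_i partial i f x), (fun i => partial i (partial i f) x).
have Ux := nbhs_singleton xU.
split=> // [|i].
  by apply: strict_gradient_partial => // i; have [] := sf [:: i] x Ux.
rewrite mxE; apply: taylor2_derive => //.
by have [_ /(_ i)] := sf [:: i] x Ux.
Qed.

Lemma norm_closure Omega M : (forall x, Omega x -> `|x| <= M) ->
  forall x, closure Omega x -> `|x| <= M.
Proof.
move=> OM x; have cl : closed [set y : 'rV[R]_n | `|y| <= M].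
  by apply: closed_le_continuous; exact: norm_continuous.
by move=> /(closureS OM); rewrite -(closure_id _).1.
Qed.

(** Strict convexity bears on the chords of the closure with distinct ends and
    interior parameters; the remaining cases of convexity are trivial. *)
Lemma strictly_convex_body Omega :
  bounded_set Omega -> strictly_convex Omega -> convex_body (closure Omega).
Proof.
move=> bO scO; split.
  apply: bounded_closed_compact; last exact: closed_closure.
  have [M [Mr OM]] := bO; exists M; split=> // N MN.
  by move=> x; apply: norm_closure; exact: OM.
move=> x y t Cx Cy /andP[t0 t1].
have [->|xy] := eqVneq x y; first by rewrite -scalerDl addrC subrK scale1r.
move: t0; rewrite le_eqVlt => /predU1P[<-|t0].
  by rewrite scale0r add0r subr0 scale1r.
move: t1; rewrite le_eqVlt => /predU1P[->|t1].
  by rewrite subrr scale0r addr0 scale1r.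
apply: subset_closure; apply: interior_subset; apply: scO => //.
by rewrite t0.
Qed.

Lemma continuous_epsilon f :
  (forall x (e : R), 0 < e -> nbhs x [set y | `|f x - f y| < e]) -> continuous f.
Proof.
by move=> fe x; apply/(@cvgrPdist_lt _ _ _ (nbhs x) _ f (f x)) => e; exact: fe.
Qed.

Lemma extend_by_oneE Omega u x :
  extend_by_one Omega u x = if x \in Omega then 1 else u x.
Proof. by []. Qed.

Lemma extension_capacitary Omega u : open Omega -> bounded_set Omega ->
  smooth_up_to_boundary (~` Omega) u ->
  (forall x, (~` closure Omega) x -> laplacian u x = 0) ->
  (forall x, boundary Omega x -> u x = 1) ->
  tends_to_at_infinity u 0 ->
  capacitary (closure Omega) (extend_by_one Omega u).
Proof.
move=> oO bO [uc us _] uh ub ui.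
have vO x : Omega x -> extend_by_one Omega u x = 1.
  by move=> Ox; rewrite extend_by_oneE mem_set.
have vN x : ~ Omega x -> extend_by_one Omega u x = u x.
  by move=> Ox; rewrite extend_by_oneE memNset.
have v1 x : closure Omega x -> extend_by_one Omega u x = 1.
  move=> Cx; have [/vO//|Ox] := pselect (Omega x).
  by rewrite vN// ub//; split=> // /interior_subset.
have ext x : ~ closure Omega x -> nbhs x (~` closure Omega).
  move=> Cx; apply: open_nbhs_nbhs; split=> //.
  by apply: closed_openC; exact: closed_closure.
split=> //.
- apply: continuous_epsilon => x e e0; have [Ox|Ox] := pselect (Omega x).
    have nO : nbhs x Omega by apply: open_nbhs_nbhs.
    apply: filterS nO => y Oy.
    by rewrite /=  !vO// subrr normr0.
  have uw : u @ within (~` Omega) (nbhs x) --> u x.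
    by move/subspace_continuousP : uc; exact.
  move/cvgrPdist_lt : uw => /(_ e e0) uw.
  have near1 : nbhs x (fun y => ~ Omega y -> `|u x - u y| < e) := uw.
  have near2 : nbhs x (fun y => Omega y -> u x = 1).
    have [Cx|Cx] := pselect (closure Omega x).
      by apply: filterE => y _; rewrite -(vN x Ox) v1.
    by apply: filterS (ext x Cx) => y Cy /subset_closure.
  apply: filterS2 near1 near2 => y h1 h2; rewrite /= (vN x Ox).
  have [Oy|Oy] := pselect (Omega y); last by rewrite vN//; exact: h1.
  by rewrite vO// h2// subrr normr0.
- move=> x Cx; apply: (@harmonic_near u).
    by apply: filterS (ext x Cx) => y Cy; rewrite vN// => /subset_closure.
  apply: (smooth_harmonic _ us); last exact: uh.
  apply: filterS (ext x Cx) => y Cy.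
  by apply: filterS (ext y Cy) => z Cz /subset_closure.
- move=> e e0; have [M uM] := ui e e0; have [N [_ ON]] := bO.
  exists (Num.max M (N + 1)) => x; rewrite gt_max => /andP[Mx Nx].
  rewrite vN; first exact: uM.
  by move=> Ox; have /= := ON (N + 1) (ltr_pwDr ltr01 (lexx N)) x Ox; rewrite leNgt Nx.
Qed.

End Extension.

Unset Implicit Arguments.

Theorem theorem1p6 (R : realType) (n : nat) (hn : (3 <= n)%N)
    (Omega1 : set 'rV[R]_n)
    (Omega1_domain : domain Omega1)
    (Omega1_smooth : smooth_boundary Omega1)
    (Omega1_bounded : bounded_set Omega1)
    (Omega1_strictly_convex : strictly_convex Omega1)
    (u : 'rV[R]_n -> R)
    (u_smooth : smooth_up_to_boundary (~` Omega1) u)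
    (u_harmonic : forall x, (~` closure Omega1) x -> laplacian u x = 0)
    (u_boundary : forall x, boundary Omega1 x -> u x = 1)
    (u_infinity : tends_to_at_infinity u 0) :
  quasiconcave Omega1 u /\
  (forall t : R, strictly_convex (superlevel (extend_by_one Omega1 u) t)).
Proof.
have n0 : (0 < n)%N by exact: leq_trans hn.
have [oO _ [x0 Ox0]] := Omega1_domain.
have bodyC := strictly_convex_body Omega1_bounded Omega1_strictly_convex.
have capv := extension_capacitary oO Omega1_bounded u_smooth u_harmonic
  u_boundary u_infinity.
have [r0 r00 ballO] : exists2 r0 : R, 0 < r0 & forall y, `|y - x0| < r0 -> Omega1 y.
  by apply/nbhs_delta; apply: open_nbhs_nbhs.
have ballC y : `|y - x0| < r0 -> closure Omega1 y by move=> /ballO/subset_closure.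
set v := extend_by_one Omega1 u in capv *.
have cv : continuous v by case: capv.
have v1 x : closure Omega1 x -> v x = 1 by case: capv => _ + _ _; exact.
split.
  move=> t; apply/convex_setW => x y /set_mem tx /set_mem ty k k0 k1.
  apply/mem_set; rewrite /superlevel/=.
  apply: le_trans (potential_quasiconcave n0 bodyC r00 ballC capv x y (t := k%:num) _).
    by rewrite le_min tx.
  by rewrite k0.
move=> t x y k; have clK : closed (superlevel v t).
  apply: (@preimage_closed _ _ v [set s : R | t <= s]).
    by move=> z _; exact: cv.
  exact: closed_ge.
rewrite -(closure_id _).1//= => tx ty xy k01.
have [t0|t0] := leP t 0.
  apply: filterE => z; apply: le_trans t0 _.
  exact: (potential_ge0 n0 bodyC capv).
have [t1|t1] := ltP t 1.
  apply: (superlevel_strict n0 bodyC r00 ballC capv) => //.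
  by rewrite t0.
have inC z : t <= v z -> closure Omega1 z.
  move=> tz; apply: contrapT => /(potential_lt1 n0 bodyC r00 ballC capv).
  by rewrite ltNge (le_trans t1 tz).
have tE : t = 1.
  by apply/eqP; rewrite eq_le t1 andbT (le_trans tx)// (potential_le1 n0 bodyC capv).
have : interior Omega1 (k *: x + (1 - k) *: y).
  by apply: Omega1_strictly_convex => //; exact: inC.
apply: filterS => z /subset_closure/v1.
by rewrite /superlevel/= tE => ->.
Qed.
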